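(* Let $d,k,r,N$ be positive integers with $1\le r\le k\le d$, and let $A\in\mathbb{R}^{d\times d}$ be a sample covariance matrix, with eigenvalue decomposition $A=\sum_{j=1}^d\lambda_j(A)\,a_ja_j^\top$, where $\lambda_1(A)\ge\cdots\ge\lambda_d(A)\ge 0$ and $a_1,\dots,a_d$ are orthonormal. For each of the three relaxations $\mathcal{CR}i$, $i\in\{1,1',2\}$, let $\mathrm{ub}^{\mathcal{CR}i}$ be the optimal value of the convex integer program (CIP) defined in the context, built with $\mathcal{CR}i$. Then $$\mathrm{opt}^{\mathcal{F}}(A)\;\le\;\mathrm{ub}^{\mathcal{CR}i}\;\le\;\rho_{\mathcal{CR}i}^2\cdot\mathrm{opt}^{\mathcal{F}}(A)+\sum_{j=1}^d\frac{r\,\theta_j^2\,\lambda_j(A)}{4N^2},\qquad i\in\{1,1',2\},$$ where $\theta_j$ is the $\ell_2$-norm of the vector of the $k$ largest-in-absolute-value entries of $a_j$.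
   Context: All matrices are real. A sample covariance matrix is a matrix $A=\frac1M XX^\top$ with $X\in\mathbb{R}^{d\times M}$. For $V\in\mathbb{R}^{d\times r}$, $V_{i,:}$ is the $i$-th row, $V_{:,j}$ the $j$-th column, and $\|V\|_0$ the number of non-zero rows. $[n]=\{1,\dots,n\}$; $I^p$ is the $p\times p$ identity; $\|V\|_{p\to q}=\max_{\|x\|_p=1}\|Vx\|_q$; $\|V\|_{\mathrm{op}}=\|V\|_{2\to 2}$; $\mathrm{diag}(h)$ is the diagonal matrix with diagonal $h$. Feasible set and optimal value: $\mathcal{F}=\{V\in\mathbb{R}^{d\times r}:V^\top V=I^r,\ \|V\|_0\le k\}$ and $\mathrm{opt}^{\mathcal{F}}(A)=\max_{V\in\mathcal{F}}\mathrm{Tr}(V^\top AV)$. Relaxations: - $\mathcal{CR}1=\{V\in\mathbb{R}^{d\times r}:\|V\|_{\mathrm{op}}\le1,\ \|V\|_{2\to1}\le\sqrt{k},\ \sum_{i=1}^d\|V_{i,:}\|_2\le\sqrt{rk}\}$. - $\mathcal{CR}1'$ is the set of $V\in\mathbb{R}^{d\times r}$ for which there is $h\in\mathbb{R}^d_+$ with $\sum_{i=1}^d\|V_{i,:}\|_2\le\sqrt{rk}$, $\sum_{i=1}^d h_i\le\frac{\pi}{2}k$, $\begin{bmatrix}I^d & V \\ V^\top & I^r\end{bmatrix}\succeq0$, $\begin{bmatrix}\mathrm{diag}(h) & V \\ V^\top & I^r\end{bmatrix}\succeq0$. - $\mathcal{CR}2$ is the set of $V\in\mathbb{R}^{d\times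 r}$ with $\|V_{:,j}\|_2^2\le1$ for all $j\in[r]$; $\|V_{:,j_1}\pm V_{:,j_2}\|_2^2\le2$ (both signs) for all $j_1\ne j_2\in[r]$; $\|V_{:,j}\|_1\le\sqrt{k}$ for all $j\in[r]$; $\sum_{i=1}^d\|V_{i,:}\|_2\le\sqrt{rk}$. Constants: $\rho_{\mathcal{CR}1}=2+\max\{6\sqrt{2\pi},12\sqrt{\log_2(50r)}\}$, $\rho_{\mathcal{CR}1'}=\sqrt{\pi/2}\,\rho_{\mathcal{CR}1}$, $\rho_{\mathcal{CR}2}=2\sqrt{r}$. Piecewise linear approximation: for $(j,i)\in[d]\times[r]$ and $\ell\in\{-N,\dots,N\}$ put $\gamma_{ji}^\ell=\frac{\ell}{N}\theta_j$. Writing $v_i=V_{:,i}$, the constraint $(g,\xi,\eta)\in\mathrm{PLA}([d]\times[r])$ means that for all $(j,i)\in[d]\times[r]$: $g_{ji}=a_j^\top v_i$; $g_{ji}=\sum_{\ell=-N}^N\gamma_{ji}^\ell\eta_{ji}^\ell$; $\xi_{ji}=\sum_{\ell=-N}^N(\gamma_{ji}^\ell)^2\eta_{ji}^\ell$; $(\eta_{ji}^\ell)_{\ell=-N}^N\in$ SOS-II; and $|g_{ji}|\le\theta_j$. Here SOS-II (special ordered set of type 2) means $\eta_{ji}^\ell\ge0$, $\sum_\ell\eta_{ji}^\ell=1$, and at most two of the $\eta_{ji}^\ell$ are non-zero, and if two are non-zero they have consecutive indices $\ell$. Convex integer program (CIP) for $\mathcal{CR}i$: $$\mathrm{ub}^{\mathcal{CR}i}=\max\Big\{\sum_{j=1}^d\lambda_j(A)\sum_{i'=1}^r\xi_{ji'}\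 :\ V\in\mathcal{CR}i,\ (g,\xi,\eta)\in\mathrm{PLA}([d]\times[r])\Big\}.$$ *)

(* Defs.v *)
From HB Require Import structures.
From mathcomp Require Import all_boot all_order all_algebra.
From mathcomp Require Import all_classical all_reals all_analysis.
Set Implicit Arguments.
Unset Strict Implicit.
Unset Printing Implicit Defensive.
Import Order.TTheory GRing.Theory Num.Theory.
Local Open Scope classical_set_scope.
Local Open Scope ring_scope.

Section Definitions.
Context {R : realType}.

Definition l1norm n (x : 'cV[R]_n) : R := \sum_i `|x i 0|.

Definition l2norm n (x : 'cV[R]_n) : R := Num.sqrt (\sum_i x i 0 ^+ 2).

(* For 0 < r the supremum is a maximum, by compactness of the unit sphere. *)
Definition indnorm r d (np : 'cV[R]_r -> R) (nq : 'cV[R]_d -> R)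
    (V : 'M[R]_(d, r)) : R :=
  sup [set nq (V *m x) | x in [set x | np x = 1]].

Definition norm_op r d (V : 'M[R]_(d, r)) : R :=
  indnorm (@l2norm r) (@l2norm d) V.

Definition norm_2to1 r d (V : 'M[R]_(d, r)) : R :=
  indnorm (@l2norm r) (@l1norm d) V.

Definition row_support_size r d (V : 'M[R]_(d, r)) : nat :=
  #|[pred i | row i V != 0]|.

Definition sum_row_norms r d (V : 'M[R]_(d, r)) : R :=
  \sum_i l2norm (row i V)^T.

Definition psdmx n (P : 'M[R]_n) : Prop :=
  P^T = P /\ forall x : 'cV[R]_n, 0 <= (x^T *m P *m x) 0 0.

Definition sample_covariance d (A : 'M[R]_d) : Prop :=
  exists M : nat, (0 < M)%N /\
  exists X : 'M[R]_(d, M), A = M%:R^-1 *: (X *m X^T).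

Definition eigendecomposition d (A : 'M[R]_d) (lambda : 'I_d -> R)
    (a : 'I_d -> 'cV[R]_d) : Prop :=
  [/\ A = \sum_j lambda j *: (a j *m (a j)^T),
      forall i j, ((a i)^T *m a j) 0 0 = (i == j)%:R,
      forall i j : 'I_d, (i <= j)%N -> lambda j <= lambda i
    & forall j, 0 <= lambda j].

Definition is_max (S : set R) (m : R) : Prop := S m /\ ubound S m.

Definition feasible (k : nat) r d : set 'M[R]_(d, r) :=
  [set V | V^T *m V = 1%:M /\ (row_support_size V <= k)%N].

Definition spca_values (k r : nat) d (A : 'M[R]_d) : set R :=
  [set \tr (V^T *m A *m V) | V in @feasible k r d].

Inductive relaxation := CR1 | CR1' | CR2.

Definition CR1_set (k : nat) r d : set 'M[R]_(d, r) :=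
  [set V | [/\ norm_op V <= 1,
               norm_2to1 V <= Num.sqrt k%:R
             & sum_row_norms V <= Num.sqrt (r * k)%:R]].

Definition CR1'_set (k : nat) r d : set 'M[R]_(d, r) :=
  [set V | exists h : 'rV[R]_d,
    [/\ forall i, 0 <= h 0 i,
        sum_row_norms V <= Num.sqrt (r * k)%:R,
        \sum_i h 0 i <= pi / 2 * k%:R,
        psdmx (block_mx 1%:M V V^T 1%:M)
      & psdmx (block_mx (diag_mx h) V V^T 1%:M)]].

Definition CR2_set (k : nat) r d : set 'M[R]_(d, r) :=
  [set V | [/\ forall j, l2norm (col j V) ^+ 2 <= 1,
               forall j1 j2, j1 != j2 ->
                 l2norm (col j1 V + col j2 V) ^+ 2 <= 2 /\
                 l2norm (col j1 V - col j2 V) ^+ 2 <= 2,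
               forall j, l1norm (col j V) <= Num.sqrt k%:R
             & sum_row_norms V <= Num.sqrt (r * k)%:R]].

Definition CR_set (c : relaxation) (k : nat) r d : set 'M[R]_(d, r) :=
  match c with
  | CR1 => @CR1_set k r d
  | CR1' => @CR1'_set k r d
  | CR2 => @CR2_set k r d
  end.

Definition log2 (x : R) : R := ln x / ln 2.

Definition rho_CR1 (r : nat) : R :=
  2 + Num.max (6 * Num.sqrt (2 * pi)) (12 * Num.sqrt (log2 (50 * r)%:R)).

Definition rho (c : relaxation) (r : nat) : R :=
  match c with
  | CR1 => rho_CR1 r
  | CR1' => Num.sqrt (pi / 2) * rho_CR1 r
  | CR2 => 2 * Num.sqrt r%:R
  end.

(* The k entries of x of largest absolute value (for k <= d). *)
Definition top_entries (k : nat) d (x : 'cV[R]_d) : 'cV[R]_k :=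
  \col_(i < k)
    nth 0 (sort (fun s t : R => `|t| <= `|s|) [seq x i 0 | i <- enum 'I_d]) i.

Definition theta (k : nat) d (a : 'I_d -> 'cV[R]_d) (j : 'I_d) : R :=
  l2norm (top_entries k (a j)).

Definition SOS2 n (eta : 'I_n -> R) : Prop :=
  [/\ forall l, 0 <= eta l,
      \sum_l eta l = 1,
      (#|[pred l | eta l != 0%R]| <= 2)%N
    & forall l1 l2 : 'I_n, (l1 < l2)%N -> eta l1 != 0 -> eta l2 != 0 ->
        l2 = l1.+1 :> nat].

(* The grid index in {-N, ..., N} is encoded as l : 'I_(2N+1), standing for
   l - N. *)
Definition gamma (N : nat) (t : R) (l : 'I_(N.*2.+1)) : R :=
  (l%:R - N%:R) / N%:R * t.

Definition PLA (N k r d : nat) (a : 'I_d -> 'cV[R]_d) (V : 'M[R]_(d, r))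
    (g xi : 'M[R]_(d, r)) (eta : 'I_d -> 'I_r -> 'I_(N.*2.+1) -> R) : Prop :=
  forall (j : 'I_d) (i : 'I_r),
    [/\ g j i = ((a j)^T *m col i V) 0 0,
        g j i = \sum_l gamma (theta k a j) l * eta j i l,
        xi j i = \sum_l gamma (theta k a j) l ^+ 2 * eta j i l,
        SOS2 (eta j i)
      & `|g j i| <= theta k a j].

(* The objective values attained by the feasible points of the convex integer
   program. *)
Definition CIP_values (c : relaxation) (N k r d : nat) (lambda : 'I_d -> R)
    (a : 'I_d -> 'cV[R]_d) : set R :=
  [set v | exists (V g xi : 'M[R]_(d, r)) (eta : 'I_d -> 'I_r -> _ -> R),
    [/\ CR_set c k V,
        @PLA N k r d a V g xi eta
      & v = \sum_j lambda j * \sum_i xi j i]].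

End Definitions.

(* Main.v *)
Require Import Defs.
From HB Require Import structures.
From mathcomp Require Import all_boot all_order all_algebra.
From mathcomp Require Import all_classical all_reals all_analysis.
From mathcomp Require Import ring lra.
Set Implicit Arguments.
Unset Strict Implicit.
Unset Printing Implicit Defensive.
Import Order.TTheory GRing.Theory Num.Theory.
Import numFieldNormedType.Exports.
Local Open Scope ring_scope.

(* The substance is Tr (V^T A V) <= rho^2 opt on each relaxation.  If U has at
   most k nonzero rows and U^T U <= c I, then Gram-Schmidt inside k coordinates
   gives Tr (U^T A U) <= c opt.

   For CR2, each column v satisfies v^T A v <= 4 opt: split <A v, v> along the k
   largest entries of A v.

   For CR1, maximise \sum_i |V_i G| over the Frobenius ball of r x r matrices G.
   First-order optimality, with Khintchine's inequality and the bound on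
   norm_2to1, yields weights H with \sum_i H_i <= 3 k and
   V^T diag(H)^-1 V <= I (the little Grothendieck inequality).  Keep row i
   independently with probability p_i = min(1, H_i / 3 + |V_i| sqrt(k / r)),
   rescaled by 1 / p_i.  The random matrix U so obtained has mean V, about 2 k
   rows, and Y = U^T U is a sum of independent rank-one matrices of norm at most
   1 with mean at most 4 I.  Its trace moments obey the Poisson recursion
   E Tr Y^(m+1) <= mu E Tr (1 + Y)^m, whence E Tr Y^m <= r (mu + m)^m; taking m
   of order log r bounds U^T U.  Cauchy-Schwarz for the form Tr (U^T A V), after
   splitting U into blocks of k rows, then bounds Tr (V^T A V).

   CR1' reduces to CR1: the two semidefinite constraints give
   |V x|_1 <= sqrt(pi k / 2) |x|, so V / sqrt(pi / 2) lies in CR1. *)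

(** * Inner products and orthonormal frames *)

(** Sampling with probabilities proportional to |V_i| alone would control the trace of the mean of Y
    but not its norm. The term H_i / 3 is there for the norm; the term |V_i| sqrt(k / r), at least
    |V_i| because r <= k, keeps every rescaled row in the unit ball. The bilinear form Tr (U^T A V)
    is used because it is linear in U: its mean is exactly T = Tr (V^T A V), so Cauchy-Schwarz gives
    T^2 <= C opt T and T cancels. The constant is C = 136 (4 + q + 1) with 2^q <= r <= 2^(q+1). Here
    136 = 34 * 4 comes from the squared number of blocks and from the norm of U^T U, and log2 (50 r)
    >= q + 5 with 136 <= 12^2 fits it under rho^2. The integer variables are handled by elimination:
    SOS-II weights force xi to be the piecewise linear interpolant of the square at g, so the
    program maximises a continuous function of V over a compact set. The interpolant exceeds the
    square by at most (theta_j / N)^2 / 4, which, weighted by lambda_j and summed over r columns, is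
    the additive error. *)

Definition dotp (R : pzRingType) n (x y : 'cV[R]_n) : R := \sum_i x i 0 * y i 0.

Section DotProduct.
Variable R : realFieldType.

Lemma dotpE n (x y : 'cV[R]_n) : (x^T *m y) 0 0 = dotp x y.
Proof. by rewrite mxE; apply: eq_bigr => i _; rewrite mxE. Qed.

Lemma dotpC n (x y : 'cV[R]_n) : dotp x y = dotp y x.
Proof. by apply: eq_bigr => i _; rewrite mulrC. Qed.

Lemma dotpDr n (x y z : 'cV[R]_n) : dotp x (y + z) = dotp x y + dotp x z.
Proof. by rewrite -big_split; apply: eq_bigr => i _; rewrite mxE mulrDr. Qed.

Lemma dotpDl n (x y z : 'cV[R]_n) : dotp (x + y) z = dotp x z + dotp y z.
Proof. by rewrite dotpC dotpDr !(dotpC z). Qed.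

Lemma dotpZr n (c : R) (x y : 'cV[R]_n) : dotp x (c *: y) = c * dotp x y.
Proof. by rewrite mulr_sumr; apply: eq_bigr => i _; rewrite mxE mulrCA. Qed.

Lemma dotpZl n (c : R) (x y : 'cV[R]_n) : dotp (c *: x) y = c * dotp x y.
Proof. by rewrite dotpC dotpZr dotpC. Qed.

Lemma dotp0r n (x : 'cV[R]_n) : dotp x 0 = 0.
Proof. by rewrite /dotp big1 // => i _; rewrite mxE mulr0. Qed.

Lemma dotp_sumr n I (s : seq I) (P : pred I) (x : 'cV[R]_n) (F : I -> 'cV[R]_n) :
  dotp x (\sum_(i <- s | P i) F i) = \sum_(i <- s | P i) dotp x (F i).
Proof.
by apply: (big_morph (dotp x)) => [y z|]; rewrite ?dotpDr ?dotp0r.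
Qed.

Lemma dotp_mulmx m n (P : 'M[R]_(m, n)) x y :
  dotp x (P *m y) = dotp (P^T *m x) y.
Proof. by rewrite -!dotpE trmx_mul trmxK mulmxA. Qed.

Lemma dotp_ge0 n (x : 'cV[R]_n) : 0 <= dotp x x.
Proof. by apply: sumr_ge0 => i _; rewrite -expr2 sqr_ge0. Qed.

Lemma dotp_eq0 n (x : 'cV[R]_n) : (dotp x x == 0) = (x == 0).
Proof.
apply/idP/eqP => [|->]; last by rewrite dotp0r.
rewrite psumr_eq0 => [/allP x0|i _]; last by rewrite -expr2 sqr_ge0.
apply/colP => i; rewrite mxE; apply/eqP.
by have := x0 i (mem_index_enum _); rewrite mulf_eq0 orbb.
Qed.

Lemma sqr_entry_le_dotp n (x : 'cV[R]_n) i : x i 0 ^+ 2 <= dotp x x.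
Proof.
rewrite /dotp (bigD1 i) //= -expr2 lerDl.
by apply: sumr_ge0 => j _; rewrite -expr2 sqr_ge0.
Qed.

(** Common source of the Cauchy-Schwarz inequalities for dot products, spectral forms, Gram matrices
    and expectations. These forms may be only semidefinite, so s = 0 has to be allowed. *)
Lemma discriminant_le (p q s : R) : 0 <= s ->
  (forall t, 0 <= p + 2 * t * q + t ^+ 2 * s) -> q ^+ 2 <= p * s.
Proof.
move=> s0 h.
have [s00|sn] := eqVneq s 0.
  subst s.
  rewrite mulr0; have [->|qn] := eqVneq q 0; first by rewrite expr0n.
  (* For s = 0 the expression is affine in t, and at this t it equals -1. *)
  have := h (- (p + 1) / (2 * q)).
  have -> : 2 * (- (p + 1) / (2 * q)) * q = - (p + 1) by field; rewrite qn.
  by rewrite mulr0 addr0; lra.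
have sp : 0 < s by rewrite lt_def sn.
have := h (- q / s).
have -> : p + 2 * (- q / s) * q + (- q / s) ^+ 2 * s = (p * s - q ^+ 2) / s.
  by field.
by rewrite pmulr_lge0 ?invr_gt0 // subr_ge0.
Qed.

Lemma cauchy_schwarz n (x y : 'cV[R]_n) :
  dotp x y ^+ 2 <= dotp x x * dotp y y.
Proof.
apply: discriminant_le (dotp_ge0 y) _ => t; have := dotp_ge0 (x + t *: y).
rewrite dotpDl !dotpDr !dotpZl !dotpZr (dotpC y x); congr (0 <= _); ring.
Qed.

(** With s = |U^T z|^2 = <z, U U^T z>, Cauchy-Schwarz and the hypothesis at U^T z give s^2 <= |z|^2
    (c s). *)
Lemma dotp_trmx_le m n (U : 'M[R]_(m, n)) (c : R) : 0 <= c ->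
  (forall x, dotp (U *m x) (U *m x) <= c * dotp x x) ->
  forall z, dotp (U^T *m z) (U^T *m z) <= c * dotp z z.
Proof.
move=> c0 h z; set s := dotp _ _.
have sE : s = dotp z (U *m (U^T *m z)) by rewrite dotp_mulmx.
have := cauchy_schwarz z (U *m (U^T *m z)); rewrite -sE => cs.
have hs := h (U^T *m z); rewrite -/s in hs.
have z0 := dotp_ge0 z; have s0 : 0 <= s := dotp_ge0 _.
have [->|sn] := eqVneq s 0; first by rewrite mulr_ge0.
have sp : 0 < s by rewrite lt_def sn.
rewrite -(ler_pM2l sp) -[leLHS]expr2 (le_trans cs) //.
by rewrite mulrA (mulrC _ (dotp z z)) ler_wpM2l // mulrC.
Qed.

Lemma kernel_vector n m (Q : 'M[R]_(n, m)) : (m < n)%N ->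
  exists2 z : 'cV[R]_n, z != 0 & Q^T *m z = 0.
Proof.
move=> mn; have : kermx Q != 0.
  by rewrite -mxrank_eq0 mxrank_ker -lt0n subn_gt0 (leq_ltn_trans (rank_leq_col Q)).
move=> /rowV0Pn[v /sub_kermxP vQ v0]; exists v^T.
  by apply: contra v0 => /eqP/(congr1 trmx); rewrite trmxK trmx0 => ->.
by rewrite -trmx_mul vQ trmx0.
Qed.

End DotProduct.

Section GramSchmidt.
Variable R : rcfType.

Lemma normalize n (w : 'cV[R]_n) : w != 0 ->
  exists c : R, dotp (c *: w) (c *: w) = 1 /\ c ^+ 2 * dotp w w = 1.
Proof.
move=> w0; have wp : 0 < dotp w w by rewrite lt_def dotp_eq0 w0 dotp_ge0.
exists (Num.sqrt (dotp w w))^-1.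
have E : (Num.sqrt (dotp w w))^-1 ^+ 2 * dotp w w = 1.
  by rewrite exprVn sqr_sqrtr ?ltW // mulVf // gt_eqF.
by rewrite dotpZl dotpZr mulrA -expr2.
Qed.

(** If u already lies in the column space of Q, the new direction is taken from the kernel of Q^T,
    which is nonzero because m < n. Hence [gram_schmidt] needs no rank assumption on B. *)
Lemma orthonormal_extend n m (Q : 'M[R]_(n, m)) (u : 'cV[R]_n) :
  (m < n)%N -> Q^T *m Q = 1%:M ->
  exists q : 'cV[R]_n, [/\ Q^T *m q = 0, dotp q q = 1
    & u = Q *m (Q^T *m u) + dotp q u *: q].
Proof.
move=> mn QQ; pose w := u - Q *m (Q^T *m u).
have Qw : Q^T *m w = 0 by rewrite mulmxBr (mulmxA Q^T Q) QQ mul1mx subrr.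
have [w0|w0] := eqVneq w 0.
  have [z z0 Qz] := kernel_vector Q mn; have [c [c1 _]] := normalize z0.
  have Qcz : Q^T *m (c *: z) = 0 by rewrite -scalemxAr Qz scaler0.
  exists (c *: z); split=> //.
  move/eqP: w0; rewrite subr_eq0 => /eqP uE.
  by rewrite {3}uE dotp_mulmx Qcz dotpC dotp0r scale0r addr0.
have [c [c1 cw]] := normalize w0; exists (c *: w); split=> //.
  by rewrite -scalemxAr Qw scaler0.
have -> : dotp (c *: w) u = c * dotp w w.
  rewrite {3}/w -scaleN1r dotpDr dotpZr dotp_mulmx Qw (dotpC 0) dotp0r.
  by rewrite mulr0 addr0 dotpZl.
by rewrite scalerA mulrAC -expr2 cw scale1r /w addrC subrK.
Qed.

Lemma gram_schmidt n m (B : 'M[R]_(n, m)) : (m <= n)%N ->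
  exists Q : 'M[R]_(n, m), Q^T *m Q = 1%:M /\ B = Q *m (Q^T *m B).
Proof.
elim: m B => [|m IH] B mn.
  by exists 0; split; apply/matrixP => i [].
pose B' : 'M[R]_(n, 1 + m) := B.
have [Q [QQ BQ]] := IH (rsubmx B') (ltnW mn).
have [q [Qq q1 uE]] := orthonormal_extend (lsubmx B') mn QQ.
have qQ : q^T *m Q = 0 by rewrite -[RHS]trmx0 -Qq trmx_mul trmxK.
have qq : q^T *m q = 1%:M.
  by apply/matrixP => i j; rewrite !ord1 dotpE q1 !mxE.
suff [E1 E2] : (row_mx q Q)^T *m row_mx q Q = 1%:M /\
    B' = row_mx q Q *m ((row_mx q Q)^T *m B') by exists (row_mx q Q).
split; first by rewrite tr_row_mx mul_col_row QQ Qq qQ qq -scalar_mx_block.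
rewrite tr_row_mx mul_col_mx mul_row_col.
rewrite -[in LHS](hsubmxK B') -[in RHS](hsubmxK B') !mul_mx_row add_row_mx.
congr row_mx.
  rewrite {1}uE addrC; congr (_ + _); apply/matrixP => i j.
  by rewrite !ord1 [RHS]mxE big_ord1 dotpE mxE mulrC.
by rewrite [X in q *m (_ *m X)]BQ (mulmxA q^T) qQ mul0mx mulmx0 add0r -BQ.
Qed.

End GramSchmidt.

(** * The objective and sparse matrices *)

Lemma superset_of_card (T : finType) (S : {set T}) k :
  (#|S| <= k <= #|T|)%N -> exists2 S' : {set T}, S \subset S' & #|S'| = k.
Proof.
move=> /andP[Sk kT]; move: {2}(k - #|S|)%N (erefl (k - #|S|)%N) => n.
elim: n S Sk => [|n IH] S Sk nE.
  by exists S => //; apply/eqP; rewrite eqn_leq Sk -subn_eq0 nE.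
have ltSk : (#|S| < k)%N by rewrite -subn_gt0 nE.
have /fintype.subsetPn[x _ xS] : ~~ (T \subset S).
  apply: contraL ltSk => /subset_leq_card TS.
  by rewrite -leqNgt (leq_trans kT).
have cxS : #|x |: S| = #|S|.+1 by rewrite cardsU1 xS.
have [||S' sS' <-] := IH (x |: S); rewrite ?cxS ?subnS ?nE //.
by exists S' => //; apply: fintype.subset_trans sS'; apply: finset.subsetUr.
Qed.

Section SpectralForm.
Variables (R : rcfType) (d : nat) (lam : 'I_d -> R) (a : 'I_d -> 'cV[R]_d).
Hypothesis lam_ge0 : forall j, 0 <= lam j.

(* With A = \sum_j lam j *: (a j *m (a j)^T), this is Tr (U^T A W). *)
Definition spectral_form r (U W : 'M[R]_(d, r)) : R :=
  \sum_j lam j * dotp (U^T *m a j) (W^T *m a j).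

Lemma spectral_formE r (U W : 'M[R]_(d, r)) :
  \tr (U^T *m (\sum_j lam j *: (a j *m (a j)^T)) *m W) = spectral_form U W.
Proof.
rewrite mulmx_sumr mulmx_suml linear_sum; apply: eq_bigr => j _.
rewrite -scalemxAr -scalemxAl /= mxtraceZ; congr (_ * _).
rewrite mulmxA -(mulmxA _ _ W) mxtrace_mulC /mxtrace big_ord1.
by rewrite -(trmxK W) -trmx_mul trmxK dotpE dotpC.
Qed.

Lemma spectral_form_ge0 r (U : 'M[R]_(d, r)) : 0 <= spectral_form U U.
Proof. by apply: sumr_ge0 => j _; rewrite mulr_ge0 ?dotp_ge0. Qed.

Lemma spectral_formDl r (U W Z : 'M[R]_(d, r)) :
  spectral_form (U + W) Z = spectral_form U Z + spectral_form W Z.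
Proof.
rewrite -big_split; apply: eq_bigr => j _.
by rewrite linearD /= mulmxDl dotpDl mulrDr.
Qed.

Lemma spectral_formZl r c (U W : 'M[R]_(d, r)) :
  spectral_form (c *: U) W = c * spectral_form U W.
Proof.
rewrite mulr_sumr; apply: eq_bigr => j _.
by rewrite linearZ /= -scalemxAl dotpZl mulrCA.
Qed.

Lemma spectral_formC r (U W : 'M[R]_(d, r)) :
  spectral_form U W = spectral_form W U.
Proof. by apply: eq_bigr => j _; rewrite dotpC. Qed.

Lemma spectral_form_suml r I (s : seq I) (P : pred I) (F : I -> 'M[R]_(d, r)) W :
  spectral_form (\sum_(i <- s | P i) F i) W =
  \sum_(i <- s | P i) spectral_form (F i) W.
Proof.
apply: (big_morph (fun U => spectral_form U W)) => [U Z|].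
  exact: spectral_formDl.
by rewrite -(scale0r 0) spectral_formZl mul0r.
Qed.

Lemma spectral_form_CS r (U W : 'M[R]_(d, r)) :
  spectral_form U W ^+ 2 <= spectral_form U U * spectral_form W W.
Proof.
apply: discriminant_le (spectral_form_ge0 W) _ => t.
have := spectral_form_ge0 (U + t *: W).
rewrite spectral_formDl !(spectral_formC _ (U + _)) !spectral_formDl.
rewrite !spectral_formZl !(spectral_formC _ (t *: W)) !spectral_formZl.
rewrite (spectral_formC U W); congr (0 <= _); ring.
Qed.

(** Gram-Schmidt on the restriction of U to k coordinates gives an orthonormal V with U = V V^T U.
    Then |U^T a_j|^2 = |U^T (V V^T a_j)|^2 <= c |V^T a_j|^2 for each j. *)
Lemma sparse_form_le r k (U : 'M[R]_(d, r)) (S : {set 'I_d}) (c : R) :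
  (r <= k <= d)%N -> (#|S| <= k)%N -> (forall i, i \notin S -> row i U = 0) ->
  0 <= c -> (forall x, dotp (U *m x) (U *m x) <= c * dotp x x) ->
  exists V : 'M[R]_(d, r), exists S' : {set 'I_d},
   [/\ V^T *m V = 1%:M, #|S'| = k, (forall i, i \notin S' -> row i V = 0)
     & spectral_form U U <= c * spectral_form V V].
Proof.
move=> /andP[rk kd] Sk US c0 Uc.
(* Enlarging S to exactly k >= r coordinates leaves room for r orthonormal columns. *)
have [|S' sSS' S'k] := @superset_of_card _ S k; first by rewrite Sk card_ord.
subst k.
pose E : 'M[R]_(d, #|S'|) := \matrix_(i, l) (i == enum_val l)%:R.
have EE : E^T *m E = 1%:M.
  apply/matrixP => l m; rewrite !mxE (bigD1 (enum_val l)) //= !mxE eqxx mul1r.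
  rewrite big1 ?addr0 => [|i /negbTE il]; last by rewrite !mxE il mul0r.
  by rewrite (inj_eq enum_val_inj).
have EU : U = E *m (E^T *m U).
  apply/row_matrixP => i; have [iS'|iS'] := boolP (i \in S'); last first.
    rewrite US; last by apply: contra iS'; apply/fintype.subsetP.
    rewrite row_mul (_ : row i E = 0) ?mul0mx //; apply/rowP => l; rewrite !mxE.
    by case: eqP iS' => // ->; rewrite enum_valP.
  apply/rowP => j; rewrite !mxE (bigD1 (enum_rank_in iS' i)) //= !mxE.
  rewrite enum_rankK_in // eqxx mul1r (bigD1 i) //= !mxE enum_rankK_in //.
  rewrite eqxx mul1r !big1 ?addr0 // => [l li|m mi]; rewrite !mxE.
    case: eqP => [iE|]; last by rewrite mul0r.
    case/eqP: li; apply: enum_val_inj; rewrite enum_rankK_in //; exact/esym.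
  by rewrite enum_rankK_in // (negbTE mi) mul0r.
have [Q [QQ BQ]] := gram_schmidt (E^T *m U) rk.
exists (E *m Q), S'; split=> //.
- by rewrite trmx_mul mulmxA -(mulmxA Q^T) EE mulmx1.
- move=> i iS'; rewrite row_mul (_ : row i E = 0) ?mul0mx //.
  apply/rowP => l; rewrite !mxE.
  by case: eqP iS' => // ->; rewrite enum_valP.
have UV : U = (E *m Q) *m ((E *m Q)^T *m U).
  by rewrite trmx_mul -!mulmxA -BQ.
have QE : (E *m Q)^T *m (E *m Q) = 1%:M.
  by rewrite trmx_mul mulmxA -(mulmxA Q^T) EE mulmx1.
rewrite mulr_sumr; apply: ler_sum => j _; rewrite mulrCA ler_wpM2l //.
have -> : U^T *m a j = U^T *m ((E *m Q) *m ((E *m Q)^T *m a j)).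
  by rewrite {1}UV trmx_mul trmx_mul trmxK -!mulmxA.
apply: le_trans (dotp_trmx_le c0 Uc _) _.
by rewrite dotp_mulmx (mulmxA _ (E *m Q)) QE mul1mx.
Qed.

End SpectralForm.

(** * Trace moments of sums of rank-one matrices *)

Section LogConvex.
Variables (R : realFieldType) (a : nat -> R).
Hypothesis a_ge0 : forall m, 0 <= a m.
Hypothesis a_lc : forall m, a m.+1 ^+ 2 <= a m * a m.+2.

Let a_eq0S m : a m = 0 -> a m.+1 = 0.
Proof.
move=> am0; apply/eqP; rewrite -sqrf_eq0 eq_le sqr_ge0 andbT.
by rewrite (le_trans (a_lc m)) // am0 mul0r.
Qed.

(** The ratios a m.+1 / a m do not decrease; the cross-multiplied form tolerates zeros, which by
    [a_eq0S] persist once they occur. *)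
Lemma logconvex_ratio j l : a j.+1 * a (j + l) <= a j * a (j + l).+1.
Proof.
elim: l => [|l IH]; first by rewrite addn0 mulrC.
rewrite addnS; have [/a_eq0S am0|am0] := eqVneq (a (j + l)%N) 0.
  by rewrite am0 mulr0 mulr_ge0.
have ap : 0 < a (j + l)%N by rewrite lt_def am0 a_ge0.
rewrite -(ler_pM2l ap); apply: (@le_trans _ _ (a j * a (j + l).+1 ^+ 2)).
  by rewrite mulrA (mulrC _ (a j.+1)) expr2 mulrA ler_wpM2r.
by rewrite [leRHS]mulrCA ler_wpM2l.
Qed.

Lemma logconvex_mul j l : a j * a l <= a 0 * a (j + l)%N.
Proof.
elim: j => [|j IH] //.
have [/a_eq0S ->|aj] := eqVneq (a j) 0; first by rewrite mul0r mulr_ge0.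
have ap : 0 < a j by rewrite lt_def aj a_ge0.
rewrite -(ler_pM2l ap); apply: (@le_trans _ _ (a j.+1 * (a 0 * a (j + l)%N))).
  by rewrite mulrCA ler_wpM2l.
by rewrite mulrCA (mulrCA (a j)) ler_wpM2l // logconvex_ratio.
Qed.

(** For a m = <u, Z^m u> with |u| = 1 this reads <u, Z u>^m <= <u, Z^m u>, so that no
    diagonalisation of Z is required. *)
Lemma logconvex_expr m : a 0 = 1 -> a 1 ^+ m <= a m.
Proof.
move=> a0; elim: m => [|m IH]; first by rewrite expr0 a0.
rewrite exprS (le_trans (ler_wpM2l (a_ge0 1) IH)) //.
by have := logconvex_mul 1 m; rewrite a0 mul1r.
Qed.

End LogConvex.

Lemma telescope_expr (R : pzRingType) (x z : R) m :
  x ^+ m - z ^+ m = \sum_(j < m) x ^+ (m.-1 - j) * (x - z) * z ^+ j.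
Proof.
elim: m => [|m IH]; first by rewrite big_ord0 subrr.
rewrite big_ord_recr /= subnn mul1r.
have -> : x ^+ m.+1 - z ^+ m.+1 = x * (x ^+ m - z ^+ m) + (x - z) * z ^+ m.
  by rewrite mulrBr mulrBl !exprS addrA subrK.
rewrite IH mulr_sumr; congr (_ + _); apply: eq_bigr => j _.
rewrite !mulrA -exprS; case: m IH j => [|m] _ j; first by case: j.
by rewrite /= subSn // -ltnS.
Qed.

(** * The positive semidefinite cone, generated by outer products *)

Section Gram.
Variables (R : realFieldType) (r : nat).
Implicit Types (P Q Z : 'M[R]_r) (w x y : 'cV[R]_r).

(** Positive semidefiniteness is encoded by an explicit decomposition: sums, congruences and powers
    then act on the list of vectors, and trace inequalities are checked on one outer product at a
    time. *)
Definition gram P := exists s : seq 'cV[R]_r, P = \sum_(v <- s) v *m v^T.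

Lemma outer_mul v x y : dotp x ((v *m v^T) *m y) = dotp v x * dotp v y :> R.
Proof.
have -> : (v *m v^T) *m y = dotp v y *: v.
  rewrite -mulmxA; apply/matrixP => i j.
  by rewrite ord1 mxE big_ord1 dotpE mxE mulrC.
by rewrite dotpZr mulrC (dotpC x).
Qed.

Lemma gram0 : gram 0.
Proof. by exists [::]; rewrite big_nil. Qed.

Lemma gramD P Q : gram P -> gram Q -> gram (P + Q).
Proof. by move=> [s ->] [t ->]; exists (s ++ t); rewrite big_cat. Qed.

Lemma gram_outer w : gram (w *m w^T).
Proof. by exists [:: w]; rewrite big_seq1. Qed.

Lemma gram_sum I (s : seq I) (B : pred I) (F : I -> 'M[R]_r) :
  (forall i, B i -> gram (F i)) -> gram (\sum_(i <- s | B i) F i).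
Proof. by move=> h; apply: big_ind => //; [exact: gram0|exact: gramD]. Qed.

Lemma gram1 : gram 1.
Proof.
exists [seq delta_mx i 0 | i : 'I_r]; rewrite big_image /=.
rewrite -[1]/(1%:M) mx1_sum_delta.
by apply: eq_bigr => i _; rewrite trmx_delta mul_delta_mx.
Qed.

Lemma gram_sym Z : gram Z -> Z^T = Z.
Proof.
move=> [s ->]; rewrite linear_sum; apply: eq_bigr => v _.
by rewrite /= trmx_mul trmxK.
Qed.

Lemma gram_congr P Z : gram P -> Z^T = Z -> gram (Z * P * Z).
Proof.
move=> [s ->] ZT; exists [seq Z *m v | v <- s]; rewrite big_map.
rewrite mulr_sumr mulr_suml; apply: eq_bigr => v _.
by rewrite trmx_mul ZT -!mulmxE !mulmxA.
Qed.

(** Z^(m+2) = Z Z^m Z is a congruence of Z^m, whence an induction by steps of two. *)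
Lemma gramX Z m : gram Z -> gram (Z ^+ m).
Proof.
move=> gZ; elim/ltn_ind: m => -[|[|m]] IH; first exact: gram1.
  by rewrite expr1.
rewrite exprSr exprS; apply: gram_congr (gram_sym gZ).
exact: IH (leqnSn _).
Qed.

Lemma gram_ge0 P x : gram P -> 0 <= dotp x (P *m x).
Proof.
move=> [s ->]; rewrite mulmx_suml dotp_sumr sumr_ge0 // => v _.
by rewrite outer_mul -expr2 sqr_ge0.
Qed.

Lemma gram_CS P x y : gram P ->
  dotp x (P *m y) ^+ 2 <= dotp x (P *m x) * dotp y (P *m y).
Proof.
move=> gP; apply: discriminant_le (gram_ge0 y gP) _ => t.
have := gram_ge0 (x + t *: y) gP.
rewrite mulmxDr -scalemxAr !dotpDl !dotpDr !dotpZl !dotpZr.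
rewrite (dotp_mulmx P y x) (gram_sym gP) (dotpC (P *m y) x).
congr (0 <= _); ring.
Qed.

(** This is Tr (P B) <= mu Tr P for B = \sum_i p_i u_i u_i^T with B <= mu I; on each term v v^T of P
    it is the hypothesis at z = v. *)
Lemma gram_trace (I : finType) (p : I -> R) (u : I -> 'cV[R]_r) (mu : R) P :
  (forall z, \sum_i p i * dotp (u i) z ^+ 2 <= mu * dotp z z) ->
  gram P -> \sum_i p i * dotp (u i) (P *m u i) <= mu * \tr P.
Proof.
move=> pu [s ->]; rewrite linear_sum /= mulr_sumr.
rewrite (eq_bigr (fun i => \sum_(v <- s) p i * dotp (u i) v ^+ 2)) => [|i _].
  rewrite exchange_big; apply: ler_sum => v _.
  by rewrite mxtrace_mulC /mxtrace big_ord1 dotpE pu.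
rewrite mulmx_suml dotp_sumr mulr_sumr; apply: eq_bigr => v _.
by rewrite outer_mul dotpC.
Qed.

Lemma gram_moment_logconvex Z w m : gram Z ->
  dotp w (Z ^+ m.+1 *m w) ^+ 2 <=
  dotp w (Z ^+ m *m w) * dotp w (Z ^+ m.+2 *m w).
Proof.
move=> gZ; have := gram_CS w (Z *m w) (gramX m gZ).
have -> : dotp (Z *m w) (Z ^+ m *m (Z *m w)) = dotp w (Z ^+ m.+2 *m w).
  by rewrite -{1}(gram_sym gZ) -dotp_mulmx !mulmxA (exprSr Z m.+1) (exprS Z m).
by rewrite mulmxA (exprSr Z m).
Qed.

End Gram.

(** * Expectation over independent random subsets *)

Section RandomSubset.
Variables (R : realFieldType) (I : finType) (p : I -> R).
Hypothesis p_ge0 : forall i, 0 <= p i.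
Hypothesis p_le1 : forall i, p i <= 1.
Implicit Types F G : {set I} -> R.

(* Expectation over the random subset containing each i independently with
   probability p i. *)
Definition expect F : R :=
  \sum_(s : {set I}) (\prod_i (if i \in s then p i else 1 - p i)) * F s.

Lemma eq_expect F G : F =1 G -> expect F = expect G.
Proof. by move=> FG; apply: eq_bigr => s _; rewrite FG. Qed.

Lemma expectD F G : expect (fun s => F s + G s) = expect F + expect G.
Proof. by rewrite -big_split; apply: eq_bigr => s _; rewrite mulrDr. Qed.

Lemma expectZ c F : expect (fun s => c * F s) = c * expect F.
Proof. by rewrite mulr_sumr; apply: eq_bigr => s _; rewrite mulrCA. Qed.

Lemma expect_sum J (t : seq J) (P : pred J) (F : J -> {set I} -> R) :
  expect (fun s => \sum_(j <- t | P j) F j s) =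
  \sum_(j <- t | P j) expect (F j).
Proof.
rewrite [RHS]exchange_big; apply: eq_bigr => s _.
by rewrite mulr_sumr.
Qed.

Lemma expect_cst c : expect (fun=> c) = c.
Proof.
rewrite /expect -mulr_suml; have := @bigA_distr R 0 1 *%R +%R I p (fun i => 1 - p i).
rewrite /= => E; rewrite -[RHS]mul1r; congr (_ * _); apply/esym.
transitivity (\prod_i (p i + (1 - p i))).
  by rewrite big1 // => i _; rewrite addrC subrK.
by rewrite E; apply: eq_bigl => s; rewrite inE.
Qed.

Lemma expect_le F G : (forall s, F s <= G s) -> expect F <= expect G.
Proof.
move=> FG; apply: ler_sum => s _; rewrite ler_wpM2l // prodr_ge0 // => i _.
by case: ifP => _; rewrite ?p_ge0 // subr_ge0.
Qed.

Lemma expect_ge0 F : (forall s, 0 <= F s) -> 0 <= expect F.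
Proof. by move=> F0; rewrite -{1}(expect_cst 0); apply: expect_le. Qed.

(** Conditioning on i being kept: the other memberships are independent of it, and F (i |: s) does
    not see whether i is in s. *)
Lemma expect_mem i F :
  expect (fun s => (i \in s)%:R * F s) = p i * expect (fun s => F (i |: s)).
Proof.
pose W (s : {set I}) := \prod_(j | j != i) (if j \in s then p j else 1 - p j).
have WE (s : {set I}) : \prod_j (if j \in s then p j else 1 - p j) =
    (if i \in s then p i else 1 - p i) * W s by rewrite (bigD1 i).
have WU (s : {set I}) : W (i |: s) = W s.
  by apply: eq_bigr => j ji; rewrite !inE (negbTE ji).
have WD (s : {set I}) : W (s :\ i) = W s.
  by apply: eq_bigr => j ji; rewrite !inE ji.
rewrite /expect (bigID (fun s : {set I} => i \in s)) /= [X in _ + X]big1.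
  rewrite addr0 mulr_sumr [RHS](bigID (fun s : {set I} => i \in s)) /=.
  (* Each s containing i is paired with s :\ i; their weights p_i W and (1 - p_i) W add up to W. *)
  rewrite [X in _ = _ + X](reindex_onto (fun s : {set I} => s :\ i) (fun s => i |: s)).
    rewrite [X in _ = _ + X](eq_bigl (fun s : {set I} => i \in s)) => [|s].
      rewrite -big_split; apply: eq_bigr => s is_ /=.
      rewrite !WE WD is_ !inE eqxx /= finset.setD1K // mul1r.
      by rewrite (finset.setUidPr _) ?finset.sub1set // -!mulrA -mulrDr -mulrDl addrC subrK mul1r.
    rewrite !inE eqxx /=; apply/eqP/idP => [<-|is_]; first by rewrite finset.setU11.
    by rewrite finset.setD1K.
  move=> s is_; apply/finset.setP => j; rewrite !inE.
  by case: eqP => //= ->; rewrite (negbTE is_).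
by move=> s /negbTE ->; rewrite mul0r mulr0.
Qed.

Lemma expect_CS F G H : (forall s, 0 <= G s) -> (forall s, 0 <= H s) ->
  (forall s, F s ^+ 2 <= G s * H s) -> expect F ^+ 2 <= expect G * expect H.
Proof.
move=> G0 H0 FGH; apply: discriminant_le (expect_ge0 H0) _ => t.
rewrite -!expectZ -!expectD; apply: expect_ge0 => s.
have [E|h] := eqVneq (H s) 0.
  have := FGH s; rewrite E mulr0 => /(conj (sqr_ge0 (F s)))/andP/le_anti/esym/eqP.
  by rewrite sqrf_eq0 => /eqP->; rewrite !mulr0 !addr0.
have hp : 0 < H s by rewrite lt_def h H0.
(* Multiplied by H s, the expression is at least (F s + t H s)^2. *)
rewrite -(pmulr_rge0 _ hp).
have := FGH s; have := sqr_ge0 (F s + t * H s); nra.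
Qed.

End RandomSubset.

Section MatrixMoments.
Variables (R : realFieldType) (r : nat).
Implicit Types (Z : 'M[R]_r) (w : 'cV[R]_r).

Lemma moment_outer_rec w (P Q : nat -> 'M[R]_r) m :
  dotp w ((\sum_(j < m) P j *m (w *m w^T) *m Q j) *m w) =
  \sum_(j < m) dotp w (P j *m w) * dotp w (Q j *m w).
Proof.
rewrite mulmx_suml dotp_sumr; apply: eq_bigr => j _.
rewrite -!mulmxA dotp_mulmx (mulmxA w) outer_mul (dotpC w).
by rewrite -dotp_mulmx.
Qed.

Lemma moment_outer_telescope w Z m :
  dotp w ((w *m w^T + Z) ^+ m *m w) = dotp w (Z ^+ m *m w) +
  \sum_(j < m) dotp w ((w *m w^T + Z) ^+ (m.-1 - j) *m w) *
               dotp w (Z ^+ j *m w).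
Proof.
rewrite -(moment_outer_rec w (fun j => (w *m w^T + Z) ^+ (m.-1 - j))).
rewrite -dotpDr -mulmxDl; congr (dotp _ (_ *m _)).
rewrite -[LHS](subrK (Z ^+ m)) addrC telescope_expr addrK.
by congr (_ + _); apply: eq_bigr => j _; rewrite -!mulmxE.
Qed.

Lemma moment_outer_ge w Z m : gram Z ->
  dotp w (Z ^+ m *m w) <= dotp w ((w *m w^T + Z) ^+ m *m w).
Proof.
move=> gZ; rewrite moment_outer_telescope lerDl sumr_ge0 // => j _.
by rewrite mulr_ge0 // gram_ge0 //; apply: gramX => //; apply: gramD (gram_outer _) _.
Qed.

Lemma moment_mul_le w Z i j : gram Z -> dotp w w <= 1 ->
  dotp w (Z ^+ i *m w) * dotp w (Z ^+ j *m w) <= dotp w (Z ^+ (i + j) *m w).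
Proof.
move=> gZ w1.
have := @logconvex_mul R (fun m => dotp w (Z ^+ m *m w))
  (fun m => gram_ge0 w (gramX m gZ)) (fun m => gram_moment_logconvex w m gZ) i j.
move=> /le_trans-> //; rewrite expr0 mul1mx ler_piMl //.
exact: gram_ge0 (gramX _ gZ).
Qed.

(** Although w w^T <= 1, powers are not operator monotone, so the comparison is made only in the
    direction w. Both sides are telescoped against Z^m; the induction hypothesis bounds the left
    factor of each term, and [moment_mul_le] merges the two resulting moments of Z into one. *)
Lemma moment_outer_le w Z m : gram Z -> dotp w w <= 1 ->
  dotp w ((w *m w^T + Z) ^+ m *m w) <= dotp w ((1 + Z) ^+ m *m w).
Proof.
move=> gZ w1; elim/ltn_ind: m => m IH.
rewrite moment_outer_telescope -[X in _ <= dotp w (X *m w)](subrK (Z ^+ m)).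
rewrite telescope_expr addrK mulmxDl dotpDr [leRHS]addrC lerD2l.
rewrite mulmx_suml dotp_sumr; apply: ler_sum => j _; rewrite mulr1.
set n := (m.-1 - j)%N.
have /IH : (n < m)%N by rewrite /n; case: m j {IH n} => [[]|m j] //=; rewrite ltnS leq_subr.
move=> /(ler_wpM2r (gram_ge0 w (gramX j gZ)))/le_trans; apply.
(* The binomial expansion of (1 + Z)^n leaves only products of two moments of Z. *)
have comm1 : GRing.comm 1 Z by apply/commr_sym/commr1.
rewrite (exprDn_comm _ comm1) mulmx_suml dotp_sumr mulr_suml.
rewrite mulr_suml mulmx_suml dotp_sumr; apply: ler_sum => l _.
have mulrnE (P : 'M[R]_r) c : dotp w ((P *+ c) *m w) = c%:R * dotp w (P *m w).
  by rewrite -scaler_nat -scalemxAl dotpZr.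
rewrite expr1n mul1r mulrnAl -exprD !mulrnE -mulrA.
rewrite ler_wpM2l //.
exact: moment_mul_le.
Qed.

End MatrixMoments.

Section MatrixChernoff.
Variables (R : realFieldType) (r : nat) (I : finType) (p : I -> R).
Variables (w : I -> 'cV[R]_r) (mu : R).
Hypothesis p_ge0 : forall i, 0 <= p i.
Hypothesis p_le1 : forall i, p i <= 1.
Hypothesis w_le1 : forall i, dotp (w i) (w i) <= 1.
Hypothesis mu_ge0 : 0 <= mu.
Hypothesis w_mean : forall z, \sum_i p i * dotp (w i) z ^+ 2 <= mu * dotp z z.

Definition outer_sum (s : {set I}) : 'M[R]_r := \sum_(i in s) w i *m (w i)^T.

Lemma gram_outer_sum s : gram (outer_sum s).
Proof. by apply: gram_sum => i _; apply: gram_outer. Qed.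

(** One factor of Y^(m+1) is expanded as the sum of the w_i w_i^T with i in s. Conditioning on i
    forces the term w_i w_i^T into the remaining power, where [moment_outer_le] replaces it by the
    identity; [gram_trace] then sums over i. *)
Lemma expect_trace_step m :
  expect p (fun s => \tr (outer_sum s ^+ m.+1)) <=
  mu * expect p (fun s => \tr ((1 + outer_sum s) ^+ m)).
Proof.
have trE s : \tr (outer_sum s ^+ m.+1) =
    \sum_i (i \in s)%:R * dotp (w i) (outer_sum s ^+ m *m w i).
  rewrite exprS {1}/outer_sum mulr_suml linear_sum big_mkcond /=.
  apply: eq_bigr => i _; case: ifP; rewrite ?mul0r ?mul1r // => _.
  by rewrite -mulmxE -mulmxA mxtrace_mulC /mxtrace big_ord1 -mulmxA dotpE.
rewrite -expectZ (eq_expect _ trE).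
rewrite expect_sum; under eq_bigr => i _ do rewrite expect_mem -expectZ.
rewrite -expect_sum; apply: expect_le => // s.
have g1 : gram ((1 + outer_sum s) ^+ m).
  by apply/gramX/gramD; [apply: gram1|apply: gram_outer_sum].
apply: le_trans (gram_trace w_mean g1); apply: ler_sum => i _.
rewrite ler_wpM2l //.
have YU : outer_sum (i |: s) = w i *m (w i)^T + outer_sum (s :\ i).
  rewrite /outer_sum (finset.big_setD1 i) ?finset.setU11 //=; congr (_ + _).
  by apply: eq_bigl => j; rewrite !inE; case: eqP.
rewrite YU (le_trans (moment_outer_le _ (gram_outer_sum _) _)) //.
(* After the split only s :\ i is left; if i was in s, [moment_outer_ge] puts its term back. *)
have [is_|is_] := boolP (i \in s); last first.
  rewrite (_ : s :\ i = s) //; apply/finset.setP => j; rewrite !inE.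
  by case: eqP => //= ->; rewrite (negbTE is_).
rewrite [in leRHS]/outer_sum (finset.big_setD1 i is_) /= addrCA.
by apply: moment_outer_ge; apply: gramD (gram_outer_sum _); apply: gram1.
Qed.

Lemma matrix_chernoff m :
  expect p (fun s => \tr (outer_sum s ^+ m)) <= r%:R * (mu + m%:R) ^+ m.
Proof.
elim/ltn_ind: m => -[|m] IH.
  by rewrite expr0 mulr1 -[leRHS](expect_cst p) expect_le // => s; rewrite mxtrace1.
apply: le_trans (expect_trace_step m) _.
have comm1 s : GRing.comm 1 (outer_sum s) by apply/commr_sym/commr1.
have trE s : \tr ((1 + outer_sum s) ^+ m) =
    \sum_(j < m.+1) 'C(m, j)%:R * \tr (outer_sum s ^+ j).
  rewrite (exprDn_comm _ (comm1 s)) linear_sum /=; apply: eq_bigr => j _.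
  by rewrite expr1n mul1r raddfMn /= mulr_natl.
rewrite (eq_expect _ trE).
rewrite expect_sum; set q := mu + m%:R.
have q0 : 0 <= q by rewrite addr_ge0.
(* For j <= m the induction hypothesis gives E Tr Y^j <= r q^j, so the binomial sum is at most r (1
   + q)^m; finally mu <= 1 + q. *)
apply: (@le_trans _ _ (mu * (r%:R * (1 + q) ^+ m))).
  rewrite ler_wpM2l // exprDn mulr_sumr; apply: ler_sum => j _.
  rewrite expectZ expr1n mul1r -[X in _ <= _ * X]mulr_natl [leRHS]mulrCA ler_wpM2l //.
  apply: le_trans (IH _ (ltn_ord j)) _; rewrite ler_wpM2l //.
  by rewrite lerXn2r ?nnegrE ?addr_ge0 // lerD2l ler_nat -ltnS.
have -> : mu + m.+1%:R = 1 + q by rewrite /q -natr1; ring.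
rewrite mulrCA ler_wpM2l // exprS.
by rewrite ler_wpM2r ?exprn_ge0 ?addr_ge0 // /q addrCA lerDl addr_ge0.
Qed.

End MatrixChernoff.

(** * Sampling rows *)

(** The position of an element in [enum s], divided by k, gives its block as quotient; inside a
    block the remainder is injective. The last block may be empty. *)
Lemma set_blocks (T : finType) (s : {set T}) k : (0 < k)%N ->
  exists f : T -> 'I_(#|s| %/ k)%N.+1,
    forall g, (#|[set i in s | f i == g]| <= k)%N.
Proof.
case: k => // k _; exists (fun i => inord (index i (enum s) %/ k.+1)%N) => g.
have fE i : i \in s ->
    (inord (index i (enum s) %/ k.+1)%N : 'I_(#|s| %/ k.+1)%N.+1) =
    (index i (enum s) %/ k.+1)%N :> nat.
  move=> is_; rewrite inordK // ltnS leq_div2r // cardE ltnW //.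
  by rewrite index_mem mem_enum.
set A := [set _ in _ | _].
pose m i : 'I_k.+1 := inord (index i (enum s) %% k.+1)%N.
rewrite -[k.+1 in leqRHS]card_ord -(@card_in_imset _ _ m A) ?max_card //.
move=> i j; rewrite !inE => /andP[is_ /eqP ig] /andP[js /eqP jg] mij.
have qij : (index i (enum s) %/ k.+1 = index j (enum s) %/ k.+1)%N.
  by rewrite -(fE i is_) ig -(fE j js) jg.
have rij : (index i (enum s) %% k.+1 = index j (enum s) %% k.+1)%N.
  by move/(congr1 val): mij; rewrite /= !inordK ?ltn_pmod.
apply: (@index_inj _ i (enum s)); rewrite ?mem_enum //.
by rewrite (divn_eq (index i _) k.+1) qij rij -divn_eq.
Qed.

Lemma sqr_sum_le (R : realFieldType) n (F : 'I_n -> R) K :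
  (forall i, F i ^+ 2 <= K) -> (\sum_i F i) ^+ 2 <= n%:R ^+ 2 * K.
Proof.
move=> FK; have := cauchy_schwarz (\col_i F i) (const_mx 1).
have -> : dotp (\col_i F i) (const_mx 1) = \sum_i F i.
  by apply: eq_bigr => i _; rewrite !mxE mulr1.
have -> : dotp (const_mx 1 : 'cV_n) (const_mx 1) = n%:R :> R.
  rewrite /dotp (eq_bigr (fun=> 1)) => [|i _]; last by rewrite !mxE mulr1.
  by rewrite sumr_const card_ord.
move=> /le_trans; apply; rewrite expr2 -mulrA mulrC ler_wpM2l //.
rewrite /dotp mulr_natl -[X in _ <= _ *+ X]card_ord -sumr_const.
by apply: ler_sum => i _; rewrite !mxE -expr2.
Qed.

Section GramTraceBound.
Variables (R : rcfType) (r : nat).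

(** A bound on the norm of Z that is affine in Tr Z^(p+1), so its expectation can be taken directly,
    without tail estimates. It rests on y / t <= 1 + (y / t)^(p+1). *)
Lemma gram_form_le (Z : 'M[R]_r) (t : R) p x : gram Z -> 0 < t ->
  dotp x (Z *m x) <= t * (1 + \tr (Z ^+ p.+1) / t ^+ p.+1) * dotp x x.
Proof.
move=> gZ t0; have [->|x0] := eqVneq x 0; first by rewrite mulmx0 dotp0r mulr0.
have [c [c1 cx]] := normalize x0; set u := c *: x in c1.
have uE P : dotp u (P *m u) = c ^+ 2 * dotp x (P *m x).
  by rewrite -scalemxAr dotpZl dotpZr mulrA -expr2.
have c2 : 0 < c ^+ 2.
  rewrite lt_def sqr_ge0 andbT; apply/eqP => c20.
  by move: cx; rewrite c20 mul0r => /eqP; rewrite eq_sym oner_eq0.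
rewrite -(ler_pM2l c2) -uE mulrCA cx mulr1.
set y := dotp u _; have y0 : 0 <= y by exact: gram_ge0.
have yp : y ^+ p.+1 <= \tr (Z ^+ p.+1).
  have := @logconvex_expr R (fun m => dotp u (Z ^+ m *m u))
    (fun m => gram_ge0 u (gramX m gZ)) (fun m => gram_moment_logconvex u m gZ) p.+1.
  rewrite expr1 mul1mx => /(_ c1)/le_trans; apply.
  have := @gram_trace R r unit (fun=> 1) (fun=> u) 1 (Z ^+ p.+1).
  rewrite !big_const !card_unit /= addr0 !mul1r; apply; last exact: gramX.
  by move=> z; rewrite big_const card_unit /= addr0 mul1r -[X in X * _]c1 cauchy_schwarz.
apply: (@le_trans _ _ (t * (1 + y ^+ p.+1 / t ^+ p.+1))); last first.
  by rewrite ler_pM2l // lerD2l ler_pM2r ?invr_gt0 ?exprn_gt0.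
rewrite -expr_div_n mulrC -ler_pdivrMr //.
have yt : 0 <= y / t by rewrite divr_ge0 // ltW.
have [y1|/ltW y1] := leP (y / t) 1; first by rewrite ler_wpDr ?exprn_ge0.
by rewrite ler_wpDl // ler_eXnr.
Qed.

End GramTraceBound.

Section RowSampling.
Variables (R : rcfType) (d r k : nat) (lam : 'I_d -> R) (a : 'I_d -> 'cV[R]_d).
Variable opt : R.
Hypotheses (r_gt0 : (0 < r)%N) (rk : (r <= k)%N).
Hypothesis lam_ge0 : forall j, 0 <= lam j.
Hypothesis opt_ge0 : 0 <= opt.

Local Notation form := (spectral_form lam a).

Hypothesis sparse_form_bound : forall (U : 'M[R]_(d, r)) (S : {set 'I_d}) c,
  (#|S| <= k)%N -> (forall i, i \notin S -> row i U = 0) -> 0 <= c ->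
  (forall x, dotp (U *m x) (U *m x) <= c * dotp x x) -> form U U <= c * opt.

Section FixedSampling.
Variables (V : 'M[R]_(d, r)) (p : 'I_d -> R) (mu : R).
Hypothesis p_ge0 : forall i, 0 <= p i.
Hypothesis p_le1 : forall i, p i <= 1.
Hypothesis mu_ge0 : 0 <= mu.
Hypothesis p_sum : \sum_i p i <= 2 * k%:R.
Hypothesis row_le : forall i, dotp (row i V)^T (row i V)^T <= p i ^+ 2.
Hypothesis row_mean : forall z,
  \sum_i (p i)^-1 * dotp (row i V)^T z ^+ 2 <= mu * dotp z z.

(** The inverse of 0 is 0, which is harmless: by [row0], a row with p i = 0 vanishes, so the sample
    still has mean V. *)
Let w i := (p i)^-1 *: (row i V)^T.

Let row0 i : p i = 0 -> row i V = 0.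
Proof.
move=> p0; have := row_le i; rewrite p0 expr0n /= => h.
have : dotp (row i V)^T (row i V)^T == 0 by rewrite eq_le h dotp_ge0.
by rewrite dotp_eq0 => /eqP/(congr1 trmx); rewrite trmxK trmx0.
Qed.

Let w_le1 i : dotp (w i) (w i) <= 1.
Proof.
rewrite dotpZl dotpZr mulrA -expr2 exprVn.
have [p0|pn] := eqVneq (p i) 0; first by rewrite row0 // trmx0 dotp0r mulr0.
by rewrite mulrC ler_pdivrMr ?mul1r // exprn_gt0 // lt_def pn p_ge0.
Qed.

Let w_mean z : \sum_i p i * dotp (w i) z ^+ 2 <= mu * dotp z z.
Proof.
apply: le_trans (row_mean z); rewrite le_eqVlt; apply/orP; left; apply/eqP.
apply: eq_bigr => i _; rewrite dotpZl exprMn mulrA.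
have [->|pn] := eqVneq (p i) 0; first by rewrite invr0 !mul0r.
by congr (_ * _); field.
Qed.

Let sample (s : {set 'I_d}) : 'M[R]_(d, r) :=
  \sum_(i in s) delta_mx i 0 *m (w i)^T.

Let sample_form s x :
  dotp (sample s *m x) (sample s *m x) = dotp x (outer_sum w s *m x).
Proof.
have sx i : (sample s *m x) i 0 = (i \in s)%:R * dotp (w i) x.
  rewrite mulmx_suml summxE big_mkcond (bigD1 i) //= big1 ?addr0 => [|j ji].
    case: ifP => _; rewrite ?mul0r // mul1r -mulmxA mxE big_ord1 dotpE.
    by rewrite mxE !eqxx mul1r.
  case: ifP => _ //; rewrite -mulmxA mxE big_ord1 mxE eq_sym (negbTE ji).
  by rewrite mul0r.
rewrite /outer_sum mulmx_suml dotp_sumr [RHS]big_mkcond; apply: eq_bigr => i _.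
by rewrite sx; case: ifP => _; rewrite ?mul0r ?mulr0 // !mul1r outer_mul (dotpC _ x) dotpC.
Qed.

Let sample_row (s : {set 'I_d}) i : i \notin s -> row i (sample s) = 0.
Proof.
move=> is_; apply/rowP => j; rewrite /sample mxE summxE mxE big1 // => l ls.
by rewrite mxE big_ord1 mxE; case: eqP is_ ls => [->/negbTE->|]//; rewrite mul0r.
Qed.

Let sample_block (s : {set 'I_d}) g (f : 'I_d -> 'I_g) l x :
  dotp (sample [set i in s | f i == l] *m x) (sample [set i in s | f i == l] *m x)
  <= dotp (sample s *m x) (sample s *m x).
Proof.
rewrite !sample_form /outer_sum !mulmx_suml !dotp_sumr.
rewrite [leLHS]big_mkcond [leRHS]big_mkcond; apply: ler_sum => i _; rewrite inE.
by case: (i \in s); case: (f i == l); rewrite //= outer_mul dotpC -expr2 sqr_ge0.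
Qed.

Let sample_form_le (s : {set 'I_d}) c : 0 <= c ->
  (forall x, dotp (sample s *m x) (sample s *m x) <= c * dotp x x) ->
  form (sample s) V ^+ 2 <= (#|s| %/ k).+1%:R ^+ 2 * (c * opt * form V V).
Proof.
move=> c0 sc; have k0 : (0 < k)%N := leq_trans r_gt0 rk.
have [f fk] := set_blocks s k0.
have -> : sample s = \sum_l sample [set i in s | f i == l].
  rewrite {1}/sample (partition_big f xpredT) //=; apply: eq_bigr => l _.
  by apply: eq_bigl => i; rewrite inE.
rewrite spectral_form_suml; apply: sqr_sum_le => l.
apply: le_trans (spectral_form_CS _ lam_ge0 _ _) _.
rewrite ler_wpM2r ?spectral_form_ge0 //.
apply: sparse_form_bound (fk l) _ c0 _; first exact: sample_row.
by move=> x; apply: le_trans (sample_block _ _ _ _) (sc x).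
Qed.

Let expect_sample : expect p (fun s => form (sample s) V) = form V V.
Proof.
have sE (s : {set 'I_d}) : form (sample s) V =
    \sum_i form (delta_mx i 0 *m (w i)^T) V * ((i \in s)%:R * 1).
  rewrite spectral_form_suml big_mkcond; apply: eq_bigr => i _.
  by case: ifP => _; rewrite ?mul0r ?mulr0 ?mulr1.
rewrite (eq_expect _ sE) expect_sum.
under eq_bigr => i _ do rewrite expectZ expect_mem expect_cst mulr1 mulrC -spectral_formZl.
rewrite -spectral_form_suml; congr form; apply/matrixP => i j.
rewrite summxE (bigD1 i) //= big1 ?addr0 => [|l li]; rewrite !mxE big_ord1 !mxE.
  rewrite !eqxx mul1r; have [p0|pn] := eqVneq (p i) 0; last by rewrite mulVKf.
  by rewrite p0 mul0r; have /rowP/(_ j) := row0 p0; rewrite !mxE.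
by rewrite eq_sym (negbTE li) mul0r mulr0.
Qed.

(** The size of s is a sum of 1 by 1 outer products, so the matrix moment bound with mean 2 k and
    exponent 2 applies: (2 k + 2)^2 <= 16 k^2. *)
Let expect_card_sqr : expect p (fun s => #|s|%:R ^+ 2) <= 16 * k%:R ^+ 2.
Proof.
have k1 : 1 <= k%:R :> R by rewrite ler1n (leq_trans r_gt0).
have m0 : 0 <= 2 * k%:R :> R by rewrite mulr_ge0.
pose one (i : 'I_d) : 'cV[R]_1 := const_mx 1.
have oneE i (z : 'cV[R]_1) : dotp (one i) z = z 0 0.
  by rewrite /dotp big_ord1 mxE mul1r.
have sE (s : {set 'I_d}) : #|s|%:R ^+ 2 = \tr (outer_sum one s ^+ 2).
  have -> : outer_sum one s = #|s|%:R%:M.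
    apply/matrixP => i j; rewrite !ord1 summxE mxE mulr1n -sumr_const.
    by apply: eq_bigr => l _; rewrite mxE big_ord1 !mxE mulr1.
  by rewrite !expr2 -mulmxE -scalar_mxM mxtrace_scalar mulr1n.
rewrite (eq_expect _ sE).
have one1 i : dotp (one i) (one i) <= 1 by rewrite oneE mxE.
have one_mean z : \sum_i p i * dotp (one i) z ^+ 2 <= 2 * k%:R * dotp z z.
  rewrite (eq_bigr (fun i => p i * z 0 0 ^+ 2)) => [|i _]; last by rewrite oneE.
  by rewrite -mulr_suml /dotp big_ord1 -expr2 ler_wpM2r ?sqr_ge0.
apply: le_trans (matrix_chernoff p_ge0 p_le1 one1 m0 one_mean 2) _.
by nra.
Qed.

Lemma row_sampling q : (r <= 2 ^ q.+1)%N ->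
  form V V <= 136 * (mu + q.+1%:R) * opt.
Proof.
move=> rq; set T := form V V.
have T0 : 0 <= T := spectral_form_ge0 _ lam_ge0 _.
have k1 : 1 <= k%:R :> R by rewrite ler1n (leq_trans r_gt0).
pose b : R := mu + q.+1%:R.
have b0 : 0 < b by rewrite ltr_wpDl // ltr0n.
(* Twice the base of the moment bound of order q + 1: the quotient of the trace moment by t^(q+1)
   has mean at most r / 2^(q+1) <= 1. *)
pose t := 2 * b; have t0 : 0 < t by rewrite mulr_gt0.
pose c s := t * (1 + \tr (outer_sum w s ^+ q.+1) / t ^+ q.+1).
have tr0 s : 0 <= \tr (outer_sum w s ^+ q.+1).
  have [v ->] := gramX q.+1 (gram_outer_sum w s).
  rewrite linear_sum sumr_ge0 // => x _.
  by rewrite /= mxtrace_mulC /mxtrace big_ord1 dotpE dotp_ge0.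
have c0 s : 0 <= c s.
  by rewrite mulr_ge0 ?(ltW t0) // addr_ge0 // divr_ge0 // exprn_ge0 // ltW.
pose n (s : {set 'I_d}) : R := (#|s| %/ k).+1%:R.
(* From n <= 1 + |s| / k follows n^2 <= 2 + 2 |s|^2 / k^2, of mean at most 2 + 2 * 16. *)
have En : expect p (fun s => n s ^+ 2) <= 34.
  have ns (s : {set 'I_d}) : n s ^+ 2 <= 2 + 2 * k%:R ^- 2 * #|s|%:R ^+ 2.
    have : n s <= 1 + #|s|%:R / k%:R.
      rewrite /n -natr1 addrC lerD2l ler_pdivlMr ?(lt_le_trans ltr01) //.
      by rewrite -natrM ler_nat leq_trunc_div.
    have : 0 <= n s by [].
    have : 0 <= #|s|%:R / k%:R :> R by rewrite divr_ge0.
    rewrite -mulrA -exprVn -exprMn (mulrC k%:R^-1).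
    set x := #|s|%:R / _; set y := n s; have := sqr_ge0 (x - 1); nra.
  apply: le_trans (expect_le p_ge0 p_le1 ns) _.
  rewrite expectD expect_cst expectZ.
  apply: (@le_trans _ _ (2 + 2 * k%:R ^- 2 * (16 * k%:R ^+ 2))).
    by rewrite lerD2l ler_wpM2l // mulr_ge0 // invr_ge0 exprn_ge0.
  rewrite le_eqVlt; apply/orP; left; apply/eqP; field.
  by rewrite gt_eqF // (lt_le_trans ltr01).
have Ec : expect p c <= 2 * t.
  rewrite expectZ expectD expect_cst mulrC ler_wpM2r ?(ltW t0) //.
  rewrite (_ : 2 = 1 + 1) ?lerD2l; last by ring.
  rewrite (eq_expect _ (fun s => mulrC _ _)) expectZ mulrC ler_pdivrMr ?exprn_gt0 //.
  rewrite mul1r (le_trans (matrix_chernoff p_ge0 p_le1 w_le1 mu_ge0 w_mean _)) //.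
  rewrite /t exprMn ler_wpM2r ?exprn_ge0 ?(ltW b0) //.
  by rewrite -natrX ler_nat.
(* The block count n and the norm bound c depend on the same s; Cauchy-Schwarz for the expectation
   separates them. With 2 t = 4 b the constant is 34 * 4 = 136. *)
have cs : T ^+ 2 <= 34 * (2 * t * (opt * T)).
  rewrite -[X in X ^+ 2]/(form V V) -[X in X ^+ 2]expect_sample.
  apply: (@le_trans _ _ (expect p (fun s => n s ^+ 2) *
                         expect p (fun s => opt * T * c s))).
    have oT0 : 0 <= opt * T by rewrite mulr_ge0.
    apply: expect_CS => // s; [exact: sqr_ge0|exact: mulr_ge0|].
    rewrite (mulrC (opt * T)) (mulrA (c s)); apply: sample_form_le => // x.
    by rewrite sample_form; apply: gram_form_le => //; apply: gram_outer_sum.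
  rewrite expectZ; apply: ler_pM => //.
  - by apply: expect_ge0 => // s; rewrite sqr_ge0.
  - by rewrite mulr_ge0 ?mulr_ge0 // expect_ge0.
  - by rewrite mulrC ler_wpM2r ?mulr_ge0.
have [->|Tn] := eqVneq T 0.
  by rewrite !mulr_ge0 // ?(ltW b0).
have Tp : 0 < T by rewrite lt_def Tn.
rewrite -(ler_pM2l Tp) -expr2 (le_trans cs) // /t /b.
rewrite le_eqVlt; apply/orP; left; apply/eqP; ring.
Qed.

End FixedSampling.
Lemma weighted_sampling (V : 'M[R]_(d, r)) (H : 'I_d -> R) q :
  (r <= 2 ^ q.+1)%N -> (forall i, 0 <= H i) -> \sum_i H i <= 3 * k%:R ->
  (forall i, H i = 0 -> row i V = 0) ->
  (forall z, \sum_i (H i)^-1 * dotp (row i V)^T z ^+ 2 <= dotp z z) ->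
  (forall z, dotp (V *m z) (V *m z) <= dotp z z) ->
  \sum_i Num.sqrt (dotp (row i V)^T (row i V)^T) <= Num.sqrt (r * k)%:R ->
  form V V <= 136 * (4 + q.+1%:R) * opt.
Proof.
move=> rq H0 Hsum HV HVle Vop Vrow.
pose n i := Num.sqrt (dotp (row i V)^T (row i V)^T).
have nE i : n i ^+ 2 = dotp (row i V)^T (row i V)^T by rewrite sqr_sqrtr ?dotp_ge0.
have n0 i : 0 <= n i by exact: sqrtr_ge0.
have r1 : 1 <= r%:R :> R by rewrite ler1n.
have rp : 0 < r%:R :> R by rewrite ltr0n.
have k0 : 0 <= k%:R :> R by [].
pose e : R := Num.sqrt (k%:R / r%:R).
have e1 : 1 <= e.
  by rewrite -[leLHS]sqrtr1 ler_sqrt ?divr_ge0 // ler_pdivlMr // mul1r ler_nat.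
have ek : e * Num.sqrt (r * k)%:R = k%:R.
  rewrite -sqrtrM ?divr_ge0 // natrM (_ : _ * _ = k%:R ^+ 2).
    by rewrite sqrtr_sqr ger0_norm.
  by field; rewrite gt_eqF.
have VE i z : (V *m z) i 0 = dotp (row i V)^T z.
  by rewrite mxE; apply: eq_bigr => j _; rewrite !mxE.
have n1 i : n i <= 1.
  have := sqr_entry_le_dotp (V *m (row i V)^T) i; rewrite VE -nE.
  move=> /le_trans/(_ (Vop _)); rewrite -nE => h.
  rewrite -(@expr_le1 _ 2) //; move: h (sqr_ge0 (n i)); set x := n i ^+ 2.
  by move=> h x0; rewrite leNgt; apply/negP => x1; nra.
(* Each summand has total at most k: the first by the bound on H, the second because e * sqrt(r k) =
   k. Since e >= 1, the second also dominates the row norm. *)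
pose qq i := H i / 3 + n i * e.
have q0 i : 0 <= qq i.
  by rewrite addr_ge0 ?divr_ge0 ?mulr_ge0 // (le_trans ler01).
have qn i : n i <= qq i.
  by rewrite ler_wpDl ?divr_ge0 // ler_peMr.
pose p i := Num.min 1 (qq i).
have p0 i : 0 <= p i by rewrite le_min ler01 q0.
have p1 i : p i <= 1 by rewrite ge_min lexx.
have psum : \sum_i p i <= 2 * k%:R.
  apply: (@le_trans _ _ (\sum_i qq i)).
    by apply: ler_sum => i _; rewrite ge_min lexx orbT.
  rewrite big_split -mulr_suml -mulr_suml /=.
  have : (\sum_i n i) * e <= k%:R.
    by rewrite -ek mulrC ler_wpM2l // (le_trans ler01).
  by move: Hsum; lra.
have prow i : dotp (row i V)^T (row i V)^T <= p i ^+ 2.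
  by rewrite -nE lerXn2r ?nnegrE // le_min n1 qn.
have pmean z : \sum_i (p i)^-1 * dotp (row i V)^T z ^+ 2 <= 4 * dotp z z.
  (* Where H_i > 0, whichever side attains the minimum, 1 / p_i <= 1 + 3 / H_i; the two terms
     contribute V^T V <= I and 3 V^T diag(H)^-1 V <= 3 I. *)
  apply: (@le_trans _ _ (\sum_i (dotp (row i V)^T z ^+ 2 +
      3 * ((H i)^-1 * dotp (row i V)^T z ^+ 2)))); last first.
    have -> : 4 * dotp z z = dotp z z + 3 * dotp z z by ring.
    rewrite big_split -mulr_sumr /= lerD ?ler_wpM2l //; apply: le_trans (Vop z).
    by apply: ler_sum => i _; rewrite -VE expr2.
  apply: ler_sum => i _; have [Hi|Hi] := eqVneq (H i) 0.
    by rewrite HV // trmx0 dotpC dotp0r expr0n !mulr0 addr0.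
  rewrite mulrA -[X in X + _]mul1r -mulrDl ler_wpM2r ?sqr_ge0 //.
  have Hp : 0 < H i by rewrite lt_def Hi H0.
  have qp : H i / 3 <= qq i by rewrite lerDl mulr_ge0 // (le_trans ler01).
  have q3 : (qq i)^-1 <= 3 / H i.
    by rewrite -[leRHS]invf_div lef_pV2 ?posrE ?divr_gt0 // (lt_le_trans _ qp) // divr_gt0.
  rewrite /p; case: (leP 1 (qq i)) => _; first by rewrite invr1 lerDl divr_ge0.
  by rewrite ler_wpDl.
exact: row_sampling p0 p1 _ psum prow pmean _ rq.
Qed.

End RowSampling.

(** * Khintchine and little Grothendieck inequalities *)

Section Rademacher.
Variables (R : rcfType) (r : nat).
Implicit Types (ws : seq 'cV[R]_r) (x w : 'cV[R]_r) (f g : 'cV[R]_r -> R).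

(* Average of g (x + \sum_i e_i w_i) over independent uniform signs e_i. *)
Fixpoint sign_average ws g x : R :=
  if ws is w :: ws' then
    (sign_average ws' g (x + w) + sign_average ws' g (x - w)) / 2
  else g x.

Lemma sign_average_le ws f g x : (forall y, f y <= g y) ->
  sign_average ws f x <= sign_average ws g x.
Proof.
move=> fg; elim: ws x => [|w ws IH] x //=.
by rewrite ler_wpM2r ?invr_ge0 // lerD.
Qed.

Lemma sign_averageD ws f g x :
  sign_average ws (fun y => f y + g y) x =
  sign_average ws f x + sign_average ws g x.
Proof. by elim: ws x => [|w ws IH] x //=; rewrite !IH; lra. Qed.

Lemma sign_averageZ ws c g x :
  sign_average ws (fun y => c * g y) x = c * sign_average ws g x.
Proof. by elim: ws x => [|w ws IH] x //=; rewrite !IH; lra. Qed.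

Lemma sign_average_cst ws c x : sign_average ws (fun=> c) x = c.
Proof. by elim: ws x => [|w ws IH] x //=; rewrite !IH; lra. Qed.

Lemma sign_average_sum n (F : 'I_n -> 'cV[R]_r -> R) ws x :
  sign_average ws (fun y => \sum_i F i y) x = \sum_i sign_average ws (F i) x.
Proof.
elim: n F => [|n IH] F.
  rewrite big_ord0 -[RHS](sign_average_cst ws 0 x).
  by apply: le_anti; rewrite !sign_average_le // => y; rewrite big_ord0.
rewrite big_ord_recl -IH -sign_averageD.
by apply: le_anti; rewrite !sign_average_le // => y; rewrite big_ord_recl.
Qed.

Let dotpBr v x w : dotp v (x - w) = dotp v x - dotp v w :> R.
Proof. by rewrite -scaleN1r dotpDr dotpZr mulN1r. Qed.

Lemma sign_average_sqr ws v x :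
  sign_average ws (fun y => dotp v y ^+ 2) x =
  dotp v x ^+ 2 + \sum_(w <- ws) dotp v w ^+ 2.
Proof.
elim: ws x => [|w ws IH] x /=; first by rewrite big_nil addr0.
by rewrite !IH big_cons dotpBr dotpDr; lra.
Qed.

Lemma sign_average_norm2 ws x :
  sign_average ws (fun y => dotp y y) x = dotp x x + \sum_(w <- ws) dotp w w.
Proof.
elim: ws x => [|w ws IH] x /=; first by rewrite big_nil addr0.
rewrite !IH big_cons -(scaleN1r w) !dotpDl !dotpDr !dotpZl !dotpZr (dotpC w x); lra.
Qed.

(** The starting point x is arbitrary for the induction, whose step has slack exactly 2 <v, w>^4. *)
Lemma sign_average_exp4 ws v x : let S := \sum_(w <- ws) dotp v w ^+ 2 in
  sign_average ws (fun y => dotp v y ^+ 4) x <=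
  dotp v x ^+ 4 + 6 * dotp v x ^+ 2 * S + 3 * S ^+ 2.
Proof.
elim: ws x => [|w ws IH] x /=; first by rewrite big_nil; lra.
have := IH (x + w); have := IH (x - w); rewrite /= big_cons dotpBr dotpDr.
set S := \sum_(_ <- _) _; set A := sign_average _ _ _; set B := sign_average _ _ _.
set y := dotp v x; set z := dotp v w => hA hB.
have z4 : 0 <= z ^+ 4 by rewrite exprn_even_ge0.
have -> : y ^+ 4 + 6 * y ^+ 2 * (z ^+ 2 + S) + 3 * (z ^+ 2 + S) ^+ 2 =
  (((y + z) ^+ 4 + 6 * (y + z) ^+ 2 * S + 3 * S ^+ 2) +
   ((y - z) ^+ 4 + 6 * (y - z) ^+ 2 * S + 3 * S ^+ 2)) / 2 + 2 * z ^+ 4 by field.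
apply: ler_wpDr; first by rewrite mulr_ge0.
by rewrite ler_wpM2r ?invr_ge0 // lerD.
Qed.

(* sqrt 3 |z| >= 3/2 z^2 / s - z^4 / (6 s^3), with equality at |z| = sqrt 3 s. *)
Lemma khintchine ws v :
  Num.sqrt (\sum_(w <- ws) dotp v w ^+ 2) <=
  Num.sqrt 3 * sign_average ws (fun y => `|dotp v y|) 0.
Proof.
set S := \sum_(w <- ws) _; set s := Num.sqrt S.
have S0 : 0 <= S by apply: sumr_ge0 => w _; rewrite sqr_ge0.
have s0 : 0 <= s := sqrtr_ge0 _.
have sS : s ^+ 2 = S by rewrite sqr_sqrtr.
have [->|sn] := eqVneq s 0.
  rewrite mulr_ge0 ?sqrtr_ge0 // -(sign_average_cst ws 0 0).
  exact: sign_average_le.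
have sp : 0 < s by rewrite lt_def sn.
pose g y := (3 / 2 / s) * dotp v y ^+ 2 + (- (6 * s ^+ 3)^-1) * dotp v y ^+ 4.
have gle y : g y <= Num.sqrt 3 * `|dotp v y|.
  rewrite /g -(real_normK (num_real (dotp v y))).
  rewrite (_ : dotp v y ^+ 4 = `|dotp v y| ^+ 4); last first.
    by rewrite -normrX ger0_norm // exprn_even_ge0.
  set z := `|_|; have z0 : 0 <= z by exact: normr_ge0.
  have c0 : 0 <= Num.sqrt 3 :> R := sqrtr_ge0 _.
  have c2 : Num.sqrt 3 ^+ 2 = 3 :> R by rewrite sqr_sqrtr.
  set c := Num.sqrt 3 in c0 c2 *; rewrite -subr_ge0.
  have -> : c * z - (3 / 2 / s * z ^+ 2 + - (6 * s ^+ 3)^-1 * z ^+ 4) =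
    z * ((z - c * s) ^+ 2 * (z + 2 * c * s)) / (6 * s ^+ 3).
    have -> : (z - c * s) ^+ 2 * (z + 2 * c * s) =
      z ^+ 3 - 3 * c ^+ 2 * s ^+ 2 * z + 2 * c * c ^+ 2 * s ^+ 3 by ring.
    by rewrite c2; field.
  have zcs : 0 <= z + 2 * c * s by rewrite addr_ge0 // !mulr_ge0.
  apply: divr_ge0; apply: mulr_ge0 => //; last exact: exprn_ge0.
  by rewrite mulr_ge0 // sqr_ge0.
rewrite -sign_averageZ; apply: le_trans (sign_average_le _ _ gle).
rewrite sign_averageD !sign_averageZ sign_average_sqr.
have := sign_average_exp4 ws v 0; rewrite /= !dotp0r -/S -sS.
set A := sign_average _ _ _ => hA.
have c3 : 0 <= (6 * s ^+ 3)^-1 by rewrite invr_ge0 mulr_ge0 // exprn_ge0.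
have := ler_wpM2l c3 hA.
have -> : (6 * s ^+ 3)^-1 * (0 ^+ 4 + 6 * 0 ^+ 2 * s ^+ 2 + 3 * s ^+ 2 ^+ 2) = s / 2.
  by field.
have -> : 3 / 2 / s * (0 ^+ 2 + s ^+ 2) = 3 / 2 * s by field.
by rewrite mulNr; lra.
Qed.

Lemma sum_khintchine n (v : 'I_n -> 'cV[R]_r) (K : R) ws : 0 <= K ->
  (forall x, \sum_i `|dotp (v i) x| <= K * Num.sqrt (dotp x x)) ->
  \sum_(w <- ws) dotp w w <= 1 ->
  \sum_i Num.sqrt (\sum_(w <- ws) dotp (v i) w ^+ 2) <= Num.sqrt 3 * K.
Proof.
move=> K0 vK w1; apply: le_trans (ler_sum _ (fun i _ => khintchine ws (v i))) _.
rewrite -mulr_sumr -sign_average_sum ler_wpM2l ?sqrtr_ge0 //.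
(* The norm |x| is replaced by (1 + |x|^2) / 2, whose sign average is known exactly. *)
have h x : \sum_i `|dotp (v i) x| <= K / 2 + K / 2 * dotp x x.
  apply: le_trans (vK x) _; have := dotp_ge0 x => x0.
  have := sqr_sqrtr x0; have := sqrtr_ge0 (dotp x x).
  set s := Num.sqrt _ => s0 <-.
  have -> : K / 2 + K / 2 * s ^+ 2 = K * ((1 + s ^+ 2) / 2) by field.
  by rewrite ler_wpM2l //; have := sqr_ge0 (s - 1); nra.
apply: le_trans (sign_average_le ws _ h) _.
rewrite sign_averageD sign_average_cst sign_averageZ sign_average_norm2.
rewrite dotp0r add0r.
by nra.
Qed.

End Rademacher.

(** * First-order optimality for sums of square roots *)

Section FirstOrder.
Variable R : rcfType.

Lemma le0_of_small_multiples (x y : R) :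
  (forall e, 0 < e -> e <= 1 -> x <= e * y) -> x <= 0.
Proof.
move=> h; rewrite leNgt; apply/negP => x0.
have d0 : 0 < x + `|y| by rewrite ltr_wpDr.
have := h (x / (x + `|y|)) (divr_gt0 x0 d0).
rewrite ler_pdivrMr // mul1r lerDl normr_ge0 => /(_ isT).
rewrite mulrAC ler_pdivlMr // ler_pM2l // => xy.
by have := ler_norm y; lra.
Qed.

(** For z > 3 the left side is negative; otherwise the difference of the squares is z^2 (3 - z) (1 +
    z) / 4. *)
Lemma sqrt1D_ge (z : R) : -1 <= z -> 1 + z / 2 - z ^+ 2 / 2 <= Num.sqrt (1 + z).
Proof.
move=> z1; have [z3|z3] := ltP 3 z.
  by apply: le_trans (sqrtr_ge0 _); have := sqr_ge0 (z - 3); nra.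
apply: le_trans (ler_norm _) _; rewrite -sqrtr_sqr ler_sqrt; last by lra.
rewrite -subr_ge0 (_ : _ - _ = z ^+ 2 * ((3 - z) * (1 + z)) / 4); last by field.
apply: divr_ge0 => //; apply: mulr_ge0; first exact: sqr_ge0.
by apply: mulr_ge0; lra.
Qed.

Lemma sqrt_perturb_ge (h y e : R) : 0 < h -> 0 <= e -> e <= 1 ->
  h + e * ((y ^+ 2 - h ^+ 2) / (2 * h)) -
    e ^+ 2 * ((y ^+ 2 - h ^+ 2) ^+ 2 / (2 * h ^+ 3)) <=
  Num.sqrt ((1 - e) * h ^+ 2 + e * y ^+ 2).
Proof.
move=> h0 e0 e1; pose z := e * (y ^+ 2 - h ^+ 2) / h ^+ 2.
have hn : h != 0 by rewrite gt_eqF.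
have z1 : -1 <= z.
  rewrite /z ler_pdivlMr ?exprn_gt0 // mulN1r.
  by have := sqr_ge0 h; have := mulr_ge0 e0 (sqr_ge0 y); nra.
have -> : (1 - e) * h ^+ 2 + e * y ^+ 2 = h ^+ 2 * (1 + z) by rewrite /z; field.
rewrite sqrtrM ?sqr_ge0 // sqrtr_sqr gtr0_norm //.
rewrite [leLHS](_ : _ = h * (1 + z / 2 - z ^+ 2 / 2)); last by rewrite /z; field.
by rewrite ler_pM2l // sqrt1D_ge.
Qed.

(** Indices with h i = 0 gain sqrt(e) |y i|, of larger order than the linear change e D of the
    others. Hence the y i must vanish there first, and only then does D <= 0 follow; 2 D is the
    difference of the two sums to compare. *)
Lemma sqrt_sum_stationary n (h y : 'I_n -> R) : (forall i, 0 <= h i) ->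
  (forall e, 0 < e -> e <= 1 ->
    \sum_i Num.sqrt ((1 - e) * h i ^+ 2 + e * y i ^+ 2) <= \sum_i h i) ->
  (forall i, h i = 0 -> y i = 0) /\ \sum_i (h i)^-1 * y i ^+ 2 <= \sum_i h i.
Proof.
move=> h0 stat.
pose D := \sum_(i | h i != 0) ((y i ^+ 2 - h i ^+ 2) / (2 * h i)).
pose C := \sum_(i | h i != 0) ((y i ^+ 2 - h i ^+ 2) ^+ 2 / (2 * h i ^+ 3)).
pose Y := \sum_(i | ~~ (h i != 0)) `|y i|.
have C0 : 0 <= C.
  by apply: sumr_ge0 => i _; rewrite divr_ge0 ?sqr_ge0 // mulr_ge0 // exprn_ge0.
have Y0 : 0 <= Y by apply: sumr_ge0.
(* With e = t^2 the optimality condition reads t Y + t^2 D <= t^4 C, where t^4 C bounds the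
   second-order remainder. *)
have key t : 0 < t -> t <= 1 -> Y + t * D <= t ^+ 3 * C.
  move=> t0 t1; have e0 : 0 < t ^+ 2 by rewrite exprn_gt0.
  have e1 : t ^+ 2 <= 1 by rewrite expr_le1 // ltW.
  have := stat _ e0 e1; rewrite (bigID (fun i => h i != 0)) /=.
  rewrite [leRHS](bigID (fun i => h i != 0)) /= [X in _ <= _ + X]big1; last first.
    by move=> i; rewrite negbK => /eqP.
  rewrite [X in _ + X <= _](eq_bigr (fun i => t * `|y i|)); last first.
    move=> i; rewrite negbK => /eqP->; rewrite expr0n mulr0 add0r -exprMn.
    by rewrite sqrtr_sqr normrM gtr0_norm.
  rewrite -mulr_sumr -/Y addr0 => s1.
  have s2 : \sum_(i | h i != 0) h i + t ^+ 2 * D - t ^+ 2 ^+ 2 * C <=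
      \sum_(i | h i != 0) Num.sqrt ((1 - t ^+ 2) * h i ^+ 2 + t ^+ 2 * y i ^+ 2).
    rewrite !mulr_sumr -sumrN -!big_split; apply: ler_sum => i hi /=.
    have hp : 0 < h i by rewrite lt_def hi h0.
    exact: sqrt_perturb_ge hp (ltW e0) e1.
  rewrite -(ler_pM2l t0).
  have -> : t * (t ^+ 3 * C) = t ^+ 2 ^+ 2 * C by ring.
  have -> : t * (Y + t * D) = t * Y + t ^+ 2 * D by ring.
  by lra.
have Yle : Y <= 0.
  apply: (@le0_of_small_multiples _ (`|D| + C)) => t t0 t1.
  have := key t t0 t1; have : t ^+ 3 * C <= t * C.
    by rewrite ler_wpM2r // exprS ler_piMr ?(ltW t0) // expr_le1 // ltW.
  have : t * - D <= t * `|D| by rewrite ler_pM2l // -normrN ler_norm.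
  by rewrite mulrN mulrDr; lra.
have YE : Y = 0 by apply: le_anti; rewrite Yle Y0.
split=> [i hi|].
  have /eqP := YE; rewrite psumr_eq0 => [/allP/(_ i)|j _]; last exact: normr_ge0.
  by rewrite mem_index_enum hi eqxx normr_eq0 => /(_ isT)/eqP.
have Dle : D <= 0.
  apply: (@le0_of_small_multiples _ C) => t t0 t1.
  have := key t t0 t1; rewrite YE add0r => h1.
  have h2 : t ^+ 3 * C <= t * (t * C).
    by rewrite mulrA -expr2 ler_wpM2r // exprS ler_piMl ?exprn_ge0 ?(ltW t0).
  by rewrite -(ler_pM2l t0) (le_trans h1).
rewrite -subr_le0 -sumrB (bigID (fun i => h i != 0)) /= [X in _ + X]big1; last first.
  by move=> i; rewrite negbK => /eqP->; rewrite invr0 mul0r subr0.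
rewrite addr0 (_ : \sum_(_ | _) _ = 2 * D) ?pmulr_rle0 //.
rewrite mulr_sumr; apply: eq_bigr => i hi; field.
exact: hi.
Qed.

End FirstOrder.

(** * Continuity, closed sets and extreme values for matrices *)

Section MatrixContinuity.
Local Open Scope classical_set_scope.
Variables (R : realType) (m n : nat).
Implicit Types f g : 'M[R]_(m, n) -> R.

Lemma continuous_entry i j : continuous (fun M : 'M[R]_(m, n) => M i j).
Proof. exact: coord_continuous. Qed.

Lemma continuous_add f g :
  continuous f -> continuous g -> continuous (fun M => f M + g M).
Proof. by move=> cf cg M; exact: cvgD (cf M) (cg M). Qed.

Lemma continuous_mul f g :
  continuous f -> continuous g -> continuous (fun M => f M * g M).
Proof. by move=> cf cg M; exact: cvgM (cf M) (cg M). Qed.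

Lemma continuous_const (c : R) : continuous (fun _ : 'M[R]_(m, n) => c).
Proof. exact: cst_continuous. Qed.

Lemma continuous_sum (I : Type) (s : seq I) (P : pred I) (F : I -> 'M[R]_(m, n) -> R) :
  (forall i, continuous (F i)) -> continuous (fun M => \sum_(i <- s | P i) F i M).
Proof.
move=> cF; elim: s => [|i s IH].
  rewrite (_ : (fun M => _) = (fun=> 0)); first exact: continuous_const.
  by apply/funext => M; rewrite big_nil.
rewrite (_ : (fun M => _) = (fun M => (if P i then F i M else 0) +
    \sum_(j <- s | P j) F j M)); last first.
  by apply/funext => M; rewrite big_cons; case: ifP; rewrite ?add0r.
apply: continuous_add IH; case: (P i); [exact: cF|exact: continuous_const].
Qed.

Lemma continuous_abs f : continuous f -> continuous (fun M => `|f M|).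
Proof. by move=> cf M; exact: cvg_norm (cf M). Qed.

Lemma continuous_sqrt f : continuous f -> continuous (fun M => Num.sqrt (f M)).
Proof.
by move=> cf M; apply: (@continuous_comp _ _ _ f Num.sqrt); [exact: cf|exact: sqrt_continuous].
Qed.

Lemma continuous_maxr f g :
  continuous f -> continuous g -> continuous (fun M => Num.max (f M) (g M)).
Proof. by move=> cf cg M; apply: continuous_max; [exact: cf|exact: cg]. Qed.

Lemma closed_le_cst f c : continuous f -> closed [set M | f M <= c].
Proof.
move=> cf; apply: (@closed_comp _ _ f [set x | x <= c]); last exact: closed_le.
by move=> M _; exact: cf.
Qed.

Lemma closed_eq_cst f c : continuous f -> closed [set M | f M = c].
Proof.
move=> cf; apply: (@closed_comp _ _ f [set x | x = c]); last exact: closed_eq.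
by move=> M _; exact: cf.
Qed.

Lemma closed_all (I : Type) (P : I -> 'M[R]_(m, n) -> Prop) :
  (forall i, closed [set M | P i M]) -> closed [set M | forall i, P i M].
Proof.
move=> cP; rewrite (_ : [set M | _] = \bigcap_i [set M | P i M]).
  by apply: closed_bigI => i _; exact: cP.
by apply/seteqP; split => M h i; [move=> _; exact: h|exact: h].
Qed.

Lemma closed_imply (b : Prop) (P : 'M[R]_(m, n) -> Prop) :
  closed [set M | P M] -> closed [set M | b -> P M].
Proof.
move=> cP; have [hb|hb] := pselect b.
  rewrite (_ : [set M | _] = [set M | P M]) //.
  by apply/seteqP; split => M /=; [apply|].
rewrite (_ : [set M | _] = setT); first exact: closedT.
by apply/seteqP; split => M //= _ /hb.
Qed.

Lemma closed_and (P Q : 'M[R]_(m, n) -> Prop) :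
  closed [set M | P M] -> closed [set M | Q M] -> closed [set M | P M /\ Q M].
Proof. by move=> cP cQ; exact: (closedI cP cQ). Qed.

Lemma continuous_vec_mx : continuous (@vec_mx R m n).
Proof.
move=> v s /= /nbhs_ballP[e e0 es]; apply/nbhs_ballP; exists e => // u [_ vu].
by apply: es; split=> // i j; rewrite !mxE; apply: vu.
Qed.

(** Compactness is obtained for the row vectors [mxvec M], where bounded closed sets are compact,
    and transported along [vec_mx]. *)
Lemma max_on_closed_bounded (K : set 'M[R]_(m, n)) f (B : R) :
  K !=set0 -> closed K -> (forall M, K M -> forall i j, `|M i j| <= B) ->
  continuous f -> exists2 M, K M & forall N, K N -> f N <= f M.
Proof.
move=> [M0 KM0] cK KB cf.
pose K' := [set v | K (@vec_mx R m n v)].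
have cK' : compact K'.
  apply: bounded_closed_compact.
    exists `|B|; split; first exact: num_real.
    move=> x Bx v K'v /=; rewrite [leLHS]/Num.norm /= mx_normrE; apply/bigmax_leP; split.
      by rewrite (le_trans _ (ltW Bx)).
    move=> [i j] _ /=; rewrite ord1; case/mxvec_indexP: j => i' j'.
    have := KB _ K'v i' j'; rewrite mxE => /le_trans; apply.
    by rewrite (le_trans (ler_norm _)) // ltW.
  apply: (@closed_comp _ _ (@vec_mx R m n) K) => // v _.
  exact: continuous_vec_mx.
have K'0 : K' !=set0 by exists (mxvec M0); rewrite /K' /= mxvecK.
have cf' : {within K', continuous (fun v => f (vec_mx v))}.
  apply: continuous_subspaceT => v.
  by apply: (@continuous_comp _ _ _ (@vec_mx R m n) f); [exact: continuous_vec_mx|exact: cf].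
have [v] := compact_EVT_max K'0 cK' cf'; rewrite inE => K'v vmax.
exists (vec_mx v) => // N KN; have := vmax (mxvec N).
by rewrite mxvecK; apply; rewrite inE /K' /= mxvecK.
Qed.

End MatrixContinuity.

(** * The little Grothendieck inequality *)

Section LittleGrothendieck.
Local Open Scope classical_set_scope.
Variables (R : realType) (d r : nat) (v : 'I_d -> 'cV[R]_r).

Let sqnorm m n (G : 'M[R]_(m, n)) : R := \sum_i \sum_j G i j ^+ 2.

Let rownorms n (G : 'M[R]_(r, n)) (i : 'I_d) : R :=
  Num.sqrt (dotp (G^T *m v i) (G^T *m v i)).

Let sqnorm_tr m n (G : 'M[R]_(m, n)) : sqnorm G = \tr (G *m G^T).
Proof.
apply: eq_bigr => i _; rewrite mxE; apply: eq_bigr => j _.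
by rewrite mxE expr2.
Qed.

Let continuous_rownorms i : continuous (fun G : 'M[R]_(r, r) => rownorms G i).
Proof.
apply: continuous_sqrt; apply: continuous_sum => l.
suff c : continuous (fun G : 'M[R]_(r, r) => (G^T *m v i) l 0).
  exact: continuous_mul.
rewrite (_ : (fun _ => _) = (fun G : 'M[R]_(r, r) => \sum_j G j l * v i j 0)).
  apply: continuous_sum => j; apply: continuous_mul; first exact: continuous_entry.
  exact: continuous_const.
by apply/funext => G; rewrite mxE; apply: eq_bigr => j _; rewrite mxE.
Qed.

(* A right orthonormal change of basis squeezes r + 1 columns into r. *)
Let compress (M : 'M[R]_(r, r.+1)) :
  exists G : 'M[R]_r, sqnorm G = sqnorm M /\ forall i, rownorms G i = rownorms M i.
Proof.
have [Q [QQ MQ]] := gram_schmidt M^T (leqnSn r).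
exists (M *m Q); split.
  by rewrite !sqnorm_tr trmx_mul -mulmxA -MQ.
move=> i; congr Num.sqrt; rewrite [in RHS]MQ trmx_mul.
set z := _ *m v i; by rewrite -(mulmxA Q) -/z [RHS]dotp_mulmx (mulmxA Q^T) QQ mul1mx.
Qed.

Let sqnorm_row_mx m n1 n2 (G : 'M[R]_(m, n1)) (F : 'M[R]_(m, n2)) :
  sqnorm (row_mx G F) = sqnorm G + sqnorm F.
Proof.
rewrite !sqnorm_tr tr_row_mx mul_row_col; exact: mxtraceD.
Qed.

Let sqnormZ m n c (G : 'M[R]_(m, n)) : sqnorm (c *: G) = c ^+ 2 * sqnorm G.
Proof.
rewrite mulr_sumr; apply: eq_bigr => i _; rewrite mulr_sumr.
by apply: eq_bigr => j _; rewrite mxE exprMn.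
Qed.

(** Only G G^T matters, a positive semidefinite matrix of trace at most 1; the segment from it to x
    x^T stays admissible. The obvious factor of the combination has r + 1 columns, hence
    [compress]. *)
Let perturb (G : 'M[R]_r) (x : 'cV[R]_r) e : 0 <= e -> e <= 1 ->
  sqnorm G <= 1 -> dotp x x = 1 ->
  exists G' : 'M[R]_r, sqnorm G' <= 1 /\ forall i,
    rownorms G' i =
    Num.sqrt ((1 - e) * rownorms G i ^+ 2 + e * dotp (v i) x ^+ 2).
Proof.
move=> e0 e1 G1 x1.
pose M : 'M[R]_(r, 1 + r) := row_mx (Num.sqrt e *: x) (Num.sqrt (1 - e) *: G).
have e1' : 0 <= 1 - e by rewrite subr_ge0.
have nM : sqnorm M <= 1.
  rewrite sqnorm_row_mx !sqnormZ !sqr_sqrtr //.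
  have -> : sqnorm x = 1.
    by rewrite -x1; apply: eq_bigr => i _; rewrite big_ord1 expr2.
  by have := ler_wpM2l e1' G1; lra.
have rM i : rownorms M i =
    Num.sqrt ((1 - e) * rownorms G i ^+ 2 + e * dotp (v i) x ^+ 2).
  congr Num.sqrt; rewrite tr_row_mx mul_col_mx /dotp big_split_ord big_ord1 [LHS]addrC /=.
  congr (_ + _).
    rewrite /rownorms sqr_sqrtr ?dotp_ge0 // mulr_sumr; apply: eq_bigr => l _.
    by rewrite col_mxEd linearZ /= -scalemxAl mxE -!expr2 exprMn sqr_sqrtr.
  rewrite col_mxEu linearZ /= -scalemxAl mxE -expr2 exprMn sqr_sqrtr //.
  by rewrite dotpE dotpC.
have [G' [G'M G'v]] := compress M; exists G'; split; first by rewrite G'M.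
by move=> i; rewrite G'v; exact: rM.
Qed.

Lemma little_grothendieck (K : R) : 0 <= K ->
  (forall x, \sum_i `|dotp (v i) x| <= K * Num.sqrt (dotp x x)) ->
  exists H : 'I_d -> R, [/\ forall i, 0 <= H i, \sum_i H i <= 3 * K ^+ 2,
    forall i, H i = 0 -> v i = 0
    & forall z, \sum_i (H i)^-1 * dotp (v i) z ^+ 2 <= dotp z z].
Proof.
move=> K0 vK.
have [||||G G1 Gmax] := @max_on_closed_bounded R r r [set G | sqnorm G <= 1]
    (fun G => \sum_i rownorms G i) 1.
- exists 0; rewrite /= /sqnorm big1 // => i _; rewrite big1 // => j _.
  by rewrite mxE expr0n.
- apply: closed_le_cst; apply: continuous_sum => i; apply: continuous_sum => j.
  by apply: continuous_mul; apply: continuous_entry.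
- move=> G /= G1 i j; rewrite -(@expr_le1 _ 2) // real_normK ?num_real //.
  apply: le_trans G1; rewrite /sqnorm (bigD1 i) //= (bigD1 j) //= -addrA lerDl.
  by rewrite addr_ge0 // sumr_ge0 // => l _; rewrite ?sumr_ge0 // => *; rewrite sqr_ge0.
- by apply: continuous_sum => i; apply: continuous_rownorms.
pose h := rownorms G; pose F := \sum_i h i.
have h0 i : 0 <= h i := sqrtr_ge0 _.
have F0 : 0 <= F by apply: sumr_ge0.
have stat x : dotp x x = 1 -> (forall i, h i = 0 -> dotp (v i) x = 0) /\
    \sum_i (h i)^-1 * dotp (v i) x ^+ 2 <= F.
  move=> x1; apply: sqrt_sum_stationary => // e e0 e1.
  have [G' [G'1 G'v]] := perturb (ltW e0) e1 G1 x1.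
  apply: le_trans (Gmax G' G'1); apply: ler_sum => i _.
  by rewrite -G'v.
have statz z : (forall i, h i = 0 -> dotp (v i) z = 0) /\
    \sum_i (h i)^-1 * dotp (v i) z ^+ 2 <= F * dotp z z.
  have [->|z0] := eqVneq z 0.
    split=> [i _|]; first by rewrite dotp0r.
    by rewrite dotp0r mulr0 big1 // => i _; rewrite dotp0r expr0n mulr0.
  have [c [c1 cz]] := normalize z0; have [s1 s2] := stat _ c1.
  have c2 : 0 < c ^+ 2.
    rewrite lt_def sqr_ge0 andbT; apply/eqP => c20.
    by move: cz; rewrite c20 mul0r => /eqP; rewrite eq_sym oner_eq0.
  split=> [i /s1/eqP|].
    by rewrite dotpZr mulf_eq0 -sqrf_eq0 gt_eqF //= => /eqP.
  rewrite -(ler_pM2l c2) mulrCA cz mulr1; apply: le_trans s2.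
  rewrite mulr_sumr; apply: ler_sum => i _.
  by rewrite dotpZr exprMn mulrCA.
have vh i : h i = 0 -> v i = 0.
  by move=> hi; apply/eqP; rewrite -dotp_eq0 (statz (v i)).1.
(* The row norms of V G are square functions over the columns of G, as in [sum_khintchine]. *)
have FK : F <= Num.sqrt 3 * K.
  have := @sum_khintchine R r d v K [seq col j G | j : 'I_r] K0 vK.
  move=> h1; apply: le_trans (h1 _).
    apply: ler_sum => i _; rewrite big_image /=; apply: ler_wsqrtr.
    rewrite {1}/dotp; apply: ler_sum => j _; rewrite -expr2.
    rewrite (_ : (G^T *m v i) j 0 = dotp (v i) (col j G)) //.
    by rewrite mxE; apply: eq_bigr => l _; rewrite !mxE mulrC.
  rewrite big_image /=; apply: le_trans G1.
  rewrite /sqnorm exchange_big; apply: ler_sum => j _.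
  by apply: ler_sum => i _; rewrite !mxE expr2.
(* Stationarity bounds the sum weighted by 1 / h by F |z|^2; the factor F normalises this and makes
   the total weight F^2. *)
exists (fun i => F * h i); split.
- by move=> i; rewrite mulr_ge0.
- rewrite -mulr_sumr -/F -expr2.
  have -> : 3 * K ^+ 2 = (Num.sqrt 3 * K) ^+ 2 by rewrite exprMn sqr_sqrtr.
  by rewrite lerXn2r ?nnegrE // mulr_ge0 ?sqrtr_ge0.
- move=> i /eqP; rewrite mulf_eq0 => /orP[/eqP FE|/eqP/vh ->//].
  apply: vh; have /eqP := FE; rewrite psumr_eq0 // => /allP/(_ i).
  by rewrite mem_index_enum => /(_ isT)/eqP.
- move=> z; have [FE|Fn] := eqVneq F 0.
    rewrite big1 ?dotp_ge0 // => i _; by rewrite FE mul0r invr0 mul0r.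
  have Fp : 0 < F by rewrite lt_def Fn.
  rewrite -(ler_pM2l Fp); apply: le_trans (statz z).2.
  rewrite mulr_sumr; apply: ler_sum => i _.
  by rewrite invfM !mulrA mulfV // mul1r.
Qed.

End LittleGrothendieck.

(** * Bounds on the relaxations *)

Section Norms.
Local Open Scope classical_set_scope.
Variable R : realType.

Lemma l2normE n (x : 'cV[R]_n) : l2norm x = Num.sqrt (dotp x x).
Proof. by congr Num.sqrt; apply: eq_bigr => i _; rewrite expr2. Qed.

Lemma l2norm_sqr n (x : 'cV[R]_n) : l2norm x ^+ 2 = dotp x x.
Proof. by rewrite l2normE sqr_sqrtr // dotp_ge0. Qed.

Lemma l2norm_ge0 n (x : 'cV[R]_n) : 0 <= l2norm x.
Proof. exact: sqrtr_ge0. Qed.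

Lemma l1norm_ge0 n (x : 'cV[R]_n) : 0 <= l1norm x.
Proof. exact: sumr_ge0. Qed.

Lemma l2norm_le n (x : 'cV[R]_n) c : 0 <= c -> (l2norm x <= c) = (dotp x x <= c ^+ 2).
Proof.
by move=> c0; rewrite -l2norm_sqr ler_pXn2r ?nnegrE ?l2norm_ge0.
Qed.

Lemma l2norm_eq1 n (x : 'cV[R]_n) : l2norm x = 1 <-> dotp x x = 1.
Proof.
rewrite -l2norm_sqr; split=> [->|]; first by rewrite expr1n.
by move/eqP; rewrite sqrf_eq1 => /orP[/eqP//|/eqP x1]; have := l2norm_ge0 x; rewrite x1; lra.
Qed.

Lemma l2norm_le_l1norm n (x : 'cV[R]_n) : l2norm x <= l1norm x.
Proof.
rewrite l2norm_le ?l1norm_ge0 // expr2 {2}/l1norm mulr_sumr.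
apply: ler_sum => i _; apply: le_trans (ler_norm _) _; rewrite normrM.
rewrite ler_wpM2r // /l1norm (bigD1 i) //= lerDl.
exact: sumr_ge0.
Qed.

Lemma dotp_le_l2norm n (x y : 'cV[R]_n) : dotp x y <= l2norm x * l2norm y.
Proof.
apply: le_trans (ler_norm _) _.
rewrite -(@ler_pXn2r _ 2) ?nnegrE ?mulr_ge0 ?l2norm_ge0 //.
by rewrite real_normK ?num_real // exprMn !l2norm_sqr cauchy_schwarz.
Qed.

(** The hypotheses r > 0 and nq <= l1norm make the set of values non-empty and bounded, so that
    [sup] is a true supremum and not its default value. *)
Lemma indnorm_le r d (nq : 'cV[R]_d -> R) (V : 'M[R]_(d, r)) c : (0 < r)%N ->
  (forall y, nq y <= l1norm y) ->
  indnorm (@l2norm R r) nq V <= c <->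
  forall x, dotp x x = 1 -> nq (V *m x) <= c.
Proof.
move=> r0 nq1; set S := [set nq (V *m x) | x in [set x | l2norm x = 1]].
have S0 : S !=set0.
  exists (nq (V *m delta_mx (Ordinal r0) 0)), (delta_mx (Ordinal r0) 0) => //=.
  apply/l2norm_eq1; rewrite /dotp (bigD1 (Ordinal r0)) //= big1 => [|i /negbTE ir].
    by rewrite mxE !eqxx mulr1 addr0.
  by rewrite mxE ir mul0r.
have Sub : has_ubound S.
  exists (\sum_i \sum_j `|V i j|) => _ [x /= /l2norm_eq1 x1 <-].
  apply: le_trans (nq1 _) _; apply: ler_sum => i _; rewrite mxE.
  apply: le_trans (ler_norm_sum _ _ _) _; apply: ler_sum => j _.
  rewrite normrM ler_piMr // -(@expr_le1 _ 2) // real_normK ?num_real //.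
  by rewrite -x1 sqr_entry_le_dotp.
split=> [h x x1|h]; last first.
  by apply: ge_sup => // _ [x /= /l2norm_eq1 x1 <-]; exact: h.
apply: le_trans h; apply: ub_le_sup => //; exists x => //=.
exact/l2norm_eq1.
Qed.

Lemma norm_op_le1 r d (V : 'M[R]_(d, r)) : (0 < r)%N ->
  norm_op V <= 1 <-> forall x, dotp (V *m x) (V *m x) <= dotp x x.
Proof.
move=> r0; rewrite /norm_op indnorm_le //; last exact: l2norm_le_l1norm.
split=> h x; last first.
  by move=> x1; rewrite l2norm_le // expr1n -[leRHS]x1; exact: h.
have [->|x0] := eqVneq x 0; first by rewrite mulmx0 !dotp0r.
have [c [c1 cx]] := normalize x0.
have := h _ c1; rewrite l2norm_le // expr1n -scalemxAr dotpZl dotpZr mulrA -expr2.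
have c2 : 0 < c ^+ 2.
  rewrite lt_def sqr_ge0 andbT; apply/eqP => c20.
  by move: cx; rewrite c20 mul0r => /eqP; rewrite eq_sym oner_eq0.
by rewrite -cx ler_pM2l.
Qed.

Lemma norm_2to1_le r d (V : 'M[R]_(d, r)) c : (0 < r)%N ->
  norm_2to1 V <= c <-> forall x, l1norm (V *m x) <= c * l2norm x.
Proof.
move=> r0; rewrite /norm_2to1 indnorm_le //.
split=> h x; last first.
  by move=> /l2norm_eq1 x1; have := h x; rewrite x1 mulr1.
have [->|x0] := eqVneq x 0.
  rewrite mulmx0 l2normE dotp0r sqrtr0 mulr0 /l1norm big1 // => i _.
  by rewrite mxE normr0.
have n0 : 0 < l2norm x.
  by rewrite l2normE sqrtr_gt0 lt_def dotp_eq0 x0 dotp_ge0.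
have u1 : dotp ((l2norm x)^-1 *: x) ((l2norm x)^-1 *: x) = 1.
  by rewrite dotpZl dotpZr -l2norm_sqr; field; rewrite gt_eqF.
have := h _ u1; rewrite -scalemxAr.
rewrite (_ : l1norm (_ *: _) = (l2norm x)^-1 * l1norm (V *m x)).
  by rewrite mulrC ler_pdivrMr.
rewrite /l1norm mulr_sumr; apply: eq_bigr => i _.
by rewrite mxE normrM gtr0_norm ?invr_gt0.
Qed.

Lemma sum_row_normsE r d (V : 'M[R]_(d, r)) :
  sum_row_norms V = \sum_i Num.sqrt (dotp (row i V)^T (row i V)^T).
Proof. by apply: eq_bigr => i _; rewrite l2normE. Qed.

Lemma row_mulE r d (V : 'M[R]_(d, r)) x i : (V *m x) i 0 = dotp (row i V)^T x.
Proof. by rewrite mxE; apply: eq_bigr => j _; rewrite !mxE. Qed.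

Lemma psd_block_form d r (P : 'M[R]_d) (V : 'M[R]_(d, r)) : P^T = P ->
  psdmx (block_mx P V V^T 1%:M) <->
  forall y x, 0 <= dotp y (P *m y) + 2 * dotp y (V *m x) + dotp x x.
Proof.
move=> PT.
have E y x : ((col_mx y x)^T *m block_mx P V V^T 1%:M *m col_mx y x) 0 0 =
    dotp y (P *m y) + 2 * dotp y (V *m x) + dotp x x.
  rewrite tr_col_mx -mulmxA mul_block_col mul_row_col mul1mx.
  rewrite [LHS]mxE !dotpE !dotpDr (dotp_mulmx V^T) trmxK (dotpC _ y); ring.
split=> [[_ h] y x|h]; first by rewrite -E.
split; first by rewrite tr_block_mx PT trmx1 trmxK.
by move=> z; rewrite -(vsubmxK z) E.
Qed.

End Norms.

(** S maximises the sum of c over sets of size k; exchanging i for j cannot increase that sum. *)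
Lemma top_set (R : realDomainType) d k (c : 'I_d -> R) : (k <= d)%N ->
  exists2 S : {set 'I_d}, #|S| = k &
    forall i j, i \in S -> j \notin S -> c j <= c i.
Proof.
move=> kd; have [|S0 _ /eqP S0k] := @superset_of_card _ (finset.set0 : {set 'I_d}) k.
  by rewrite cards0 card_ord.
have [S Sk Smax] := @Order.TotalTheory.arg_maxP _ R _ S0 (fun S => #|S| == k)
  (fun S => \sum_(i in S) c i) S0k.
exists S => [|i j iS jS]; first exact/eqP.
have jSi : j \notin S :\ i by rewrite !inE (negbTE jS) andbF.
have := Smax (j |: S :\ i).
rewrite cardsU1 jSi -(eqP Sk) (cardsD1 i S) iS eqxx => /(_ isT) /=.
by rewrite (big_setU1 _ jSi) /= [leRHS](big_setD1 i iS) /= lerD2r.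
Qed.

(** The least q with r <= 2^(q+1) has 2^q <= r, so 2^(q+5) <= 32 r. The exponent q + 5 is the 4 + (q
    + 1) of [weighted_sampling]. *)
Lemma sampling_exponent r : (0 < r)%N ->
  exists q, (r <= 2 ^ q.+1 /\ 2 ^ (q + 5) <= 50 * r)%N.
Proof.
move=> r0; rewrite -[X in (50 * X)%N](prednK r0).
have ex : exists q, (r <= 2 ^ q.+1)%N.
  by exists r; rewrite (leq_trans (ltnW (ltn_expl r (ltnSn 1)))) // leq_pexp2l.
case: (ex_minnP ex) => -[|q] rq qmin; [by exists 0; split; last exact: leq_trans (leq_pmulr 50 _)|].
exists q.+1; split=> //; have : ~~ (r <= 2 ^ q.+1)%N.
  by apply/negP => /qmin; rewrite ltnn.
rewrite -ltnNge => lt; case: r lt {r0 ex rq qmin} => // r lt.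
rewrite addSnnS expnD (leq_trans (_ : _ <= 32 * r.+1)%N) ?leq_mul2r ?orbT //.
by rewrite (expnD 2 1 5) mulnA mulnC -(expnSr 2 q) leq_mul2l ltnW.
Qed.

(** * Approximation ratio of each relaxation *)

Section RelaxationBounds.
Local Open Scope classical_set_scope.
Variables (R : realType) (d k r : nat) (lam : 'I_d -> R) (a : 'I_d -> 'cV[R]_d).
Variable opt : R.
Hypotheses (r_gt0 : (0 < r)%N) (rk : (r <= k)%N) (kd : (k <= d)%N).
Hypothesis lam_ge0 : forall j, 0 <= lam j.
Hypothesis opt_ge0 : 0 <= opt.

Local Notation form := (spectral_form lam a).

Hypothesis sparse_form_bound : forall (U : 'M[R]_(d, r)) (S : {set 'I_d}) c,
  (#|S| <= k)%N -> (forall i, i \notin S -> row i U = 0) -> 0 <= c ->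
  (forall x, dotp (U *m x) (U *m x) <= c * dotp x x) -> form U U <= c * opt.

Lemma rho_CR1_ge q : (2 ^ (q + 5) <= 50 * r)%N ->
  144 * (q + 5)%:R <= rho_CR1 r ^+ 2 :> R.
Proof.
move=> qr; have ln2 : 0 < ln 2 :> R by rewrite ln_gt0 // ltr1n.
have L : (q + 5)%:R <= log2 (50 * r)%:R :> R.
  rewrite /log2 ler_pdivlMr // mulr_natl -lnXn //.
  by rewrite ler_ln ?posrE ?exprn_gt0 ?ltr0n ?muln_gt0 // -natrX ler_nat.
have L0 : 0 <= log2 (50 * r)%:R :> R by apply: le_trans L.
have s0 : 0 <= 12 * Num.sqrt (log2 (50 * r)%:R) :> R by rewrite mulr_ge0 ?sqrtr_ge0.
apply: (@le_trans _ _ ((12 * Num.sqrt (log2 (50 * r)%:R)) ^+ 2)).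
  rewrite exprMn sqr_sqrtr // (_ : 12 ^+ 2 = 144) ?ler_wpM2l //; ring.
have h : 12 * Num.sqrt (log2 (50 * r)%:R) <= rho_CR1 r :> R.
  by rewrite /rho_CR1 ler_wpDl // le_max lexx orbT.
by rewrite lerXn2r ?nnegrE // (le_trans s0).
Qed.

Lemma CR1_form_le (V : 'M[R]_(d, r)) : CR1_set k V ->
  form V V <= rho CR1 r ^+ 2 * opt.
Proof.
move=> [/(norm_op_le1 _ r_gt0) Vop V21 Vrow].
have [q [rq qr]] := sampling_exponent r_gt0.
have [|x|H [H0 Hsum HV HVle]] :=
    @little_grothendieck R d r (fun i => (row i V)^T) (Num.sqrt k%:R).
- exact: sqrtr_ge0.
- rewrite -l2normE; move/(norm_2to1_le _ _ r_gt0): V21 => /(_ x).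
  by congr (_ <= _); apply: eq_bigr => i _; rewrite row_mulE.
rewrite sqr_sqrtr // in Hsum; rewrite sum_row_normsE in Vrow.
have HV' i : H i = 0 -> row i V = 0.
  by move=> /HV/(congr1 trmx); rewrite trmxK trmx0.
apply: le_trans (weighted_sampling r_gt0 rk lam_ge0 opt_ge0 sparse_form_bound
  rq H0 Hsum HV' HVle Vop Vrow) _.
rewrite ler_wpM2r //; apply: le_trans (rho_CR1_ge qr).
have -> : 4 + q.+1%:R = (q + 5)%:R :> R.
  by rewrite addnS -natr1 -[in RHS]natr1 natrD; ring.
by rewrite ler_wpM2r // ler_nat.
Qed.

Lemma half_pi_ge1 : 1 <= pi / 2 :> R.
Proof. by have := pi_ge2 R; lra. Qed.

Lemma CR1'_form_le (V : 'M[R]_(d, r)) : CR1'_set k V ->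
  form V V <= rho CR1' r ^+ 2 * opt.
Proof.
move=> [h [h0 Vrow hsum]].
rewrite !psd_block_form ?trmx1 ?tr_diag_mx // => Vop Vh.
have hp1 := half_pi_ge1; have hp0 : 0 < pi / 2 :> R by apply: lt_le_trans hp1.
(* Scaling by c absorbs the factor pi / 2 in the bound on h; since c <= 1 the other constraints
   survive. *)
pose c : R := (Num.sqrt (pi / 2))^-1.
have s0 : 0 < Num.sqrt (pi / 2) :> R by rewrite sqrtr_gt0.
have c0 : 0 < c by rewrite invr_gt0.
have c1 : c <= 1 by rewrite invf_le1 // -[leLHS]sqrtr1 ler_wsqrtr.
have c2 : c ^+ 2 = (pi / 2)^-1 by rewrite exprVn sqr_sqrtr // ltW.
have Vop' x : dotp (V *m x) (V *m x) <= dotp x x.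
  have := Vop (- (V *m x)) x.
  by rewrite mul1mx -scaleN1r !dotpZl !dotpZr; lra.
have cV : CR1_set k (c *: V).
  split.
  - apply/(norm_op_le1 _ r_gt0) => x; rewrite -scalemxAl dotpZl dotpZr mulrA -expr2.
    apply: le_trans (Vop' x); rewrite ler_piMl ?dotp_ge0 //.
    by rewrite expr_le1 // ltW.
  - apply/(norm_2to1_le _ _ r_gt0) => x.
    (* The signs of V x linearise the norm: |V x|_1 = <V^T s, x>. The second block constraint tested
       at (s, - V^T s) gives |V^T s|^2 <= \sum_i h_i. *)
    pose s := \col_i Num.sg ((V *m x) i 0).
    have E : l1norm (c *: V *m x) = c * dotp s (V *m x).
      rewrite /l1norm mulr_sumr; apply: eq_bigr => i _.
      by rewrite -scalemxAl [X in `|X|]mxE normrM gtr0_norm // [s i 0]mxE -normrEsg.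
    have sV : dotp (V^T *m s) (V^T *m s) <= pi / 2 * k%:R.
      apply: le_trans hsum.
      have := Vh s ((-1) *: (V^T *m s)).
      rewrite -scalemxAr !dotpZl !dotpZr (dotp_mulmx V).
      have : dotp s (diag_mx h *m s) <= \sum_i h 0 i.
        apply: ler_sum => i _; rewrite mul_diag_mx !mxE mulrCA -expr2.
        by rewrite ler_piMr // sqr_sg; case: (_ != 0).
      by lra.
    rewrite E (dotp_mulmx V); apply: (@le_trans _ _ (c * (l2norm (V^T *m s) * l2norm x))).
      by rewrite ler_pM2l // dotp_le_l2norm.
    rewrite mulrA ler_wpM2r ?l2norm_ge0 // /c mulrC ler_pdivrMr //.
    by rewrite -sqrtrM // l2normE ler_wsqrtr // mulrC.
  - apply: le_trans Vrow; apply: ler_sum => i _.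
    rewrite !l2normE ler_wsqrtr // linearZ /= linearZ /= dotpZl dotpZr mulrA -expr2.
    by rewrite ler_piMl ?dotp_ge0 // expr_le1 // ltW.
have := CR1_form_le cV.
rewrite spectral_formZl spectral_formC spectral_formZl mulrA -expr2 c2 /rho.
by rewrite mulrC ler_pdivrMr // exprMn sqr_sqrtr ?(ltW hp0) // [leRHS]mulrC mulrA.
Qed.

Lemma spectral_form_col (V : 'M[R]_(d, r)) :
  form V V = \sum_i form (col i V) (col i V).
Proof.
rewrite /spectral_form exchange_big; apply: eq_bigr => j _.
rewrite -mulr_sumr; congr (_ * _); apply: eq_bigr => i _.
rewrite /dotp big_ord1.
suff -> : (V^T *m a j) i 0 = ((col i V)^T *m a j) 0 0 by [].
by rewrite !mxE; apply: eq_bigr => l _; rewrite !mxE.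
Qed.

(* Splitting c = A v over the k largest entries of c and the rest, each part of
   <c, v> is at most the norm of the former. *)
Lemma sparse_vector_form_le (v : 'cV[R]_d) : dotp v v <= 1 ->
  l1norm v <= Num.sqrt k%:R -> form v v <= 4 * opt.
Proof.
move=> v1 vk; pose c := \sum_j (lam j * dotp (a j) v) *: a j.
have cE u : dotp c u = form v u.
  rewrite dotpC dotp_sumr; apply: eq_bigr => j _.
  rewrite dotpZr -mulrA; congr (_ * _).
  by rewrite [RHS]/dotp big_ord1 !dotpE !(dotpC (a j)).
have [S Sk Smax] := top_set (fun i => c i 0 ^+ 2) kd.
pose u := \col_i (if i \in S then c i 0 else 0).
pose n2 := dotp u u; pose n := Num.sqrt n2.
have n20 : 0 <= n2 := dotp_ge0 u.
have n0 : 0 <= n := sqrtr_ge0 _.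
have nn : n ^+ 2 = n2 by rewrite sqr_sqrtr.
have n2E : n2 = \sum_(i in S) c i 0 ^+ 2.
  rewrite [RHS]big_mkcond; apply: eq_bigr => i _; rewrite mxE expr2.
  by case: ifP; rewrite ?mul0r.
have cu : dotp c u = n2.
  apply: eq_bigr => i _; rewrite !mxE.
  by case: ifP; rewrite ?mulr0 ?mul0r.
pose T := form v v; have T0 : 0 <= T := spectral_form_ge0 _ lam_ge0 _.
have k0 : 0 < k%:R :> R by rewrite ltr0n (leq_trans r_gt0).
have Tn : T <= 2 * n.
  rewrite /T -cE /dotp (bigID (fun i => i \in S)) /= (_ : 2 * n = n + n); last by ring.
  apply: lerD.
    apply: le_trans (_ : dotp u v <= _).
      rewrite le_eqVlt [X in _ == X](_ : _ = \sum_(i in S) c i 0 * v i 0) ?eqxx //.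
      rewrite [RHS]big_mkcond; apply: eq_bigr => i _; rewrite mxE.
      by case: ifP; rewrite ?mul0r.
    apply: le_trans (dotp_le_l2norm _ _) _; rewrite !l2normE ler_piMr //.
    by rewrite -[leRHS]sqrtr1 ler_wsqrtr.
  apply: (@le_trans _ _ (\sum_(i | i \notin S) n / Num.sqrt k%:R * `|v i 0|)).
    apply: ler_sum => j jS; apply: le_trans (ler_norm _) _; rewrite normrM.
    rewrite ler_wpM2r // ler_pdivlMr ?sqrtr_gt0 // -sqrtr_sqr -sqrtrM ?sqr_ge0 //.
    rewrite ler_wsqrtr // n2E mulr_natr -Sk -sumr_const.
    by apply: ler_sum => i iS; apply: Smax.
  rewrite -mulr_sumr; apply: (@le_trans _ _ (n / Num.sqrt k%:R * l1norm v)).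
    rewrite ler_wpM2l ?divr_ge0 ?sqrtr_ge0 // /l1norm.
    by rewrite [leRHS](bigID (fun i => i \in S)) /= lerDr sumr_ge0.
  rewrite mulrAC ler_pdivrMr ?sqrtr_gt0 //.
  by rewrite ler_wpM2l.
have uopt : form u u <= n2 * opt.
  (* The sparse bound is about r columns, so u is embedded as u e^T with a unit vector e. *)
  pose e : 'cV[R]_r := delta_mx (Ordinal r_gt0) 0.
  have ee : dotp e e = 1.
    rewrite /dotp (bigD1 (Ordinal r_gt0)) //= big1 => [|i /negbTE ir].
      by rewrite mxE !eqxx mulr1 addr0.
    by rewrite mxE ir mul0r.
  have ux x : (u *m e^T) *m x = dotp e x *: u.
    rewrite -mulmxA; apply/matrixP => i j.
    by rewrite ord1 [LHS]mxE big_ord1 dotpE [RHS]mxE mulrC.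
  have -> : form u u = form (u *m e^T) (u *m e^T).
    apply: eq_bigr => j _; congr (_ * _); rewrite trmx_mul trmxK -mulmxA.
    rewrite [LHS]/dotp big_ord1 dotpE.
    have -> : e *m (u^T *m a j) = dotp u (a j) *: e.
      apply/matrixP => i l.
      by rewrite ord1 [LHS]mxE big_ord1 dotpE [RHS]mxE mulrC.
    by rewrite dotpZl dotpZr ee mulr1.
  apply: (@sparse_form_bound _ S) => //; first by rewrite Sk.
    move=> i iS; rewrite row_mul (_ : row i u = 0) ?mul0mx //.
    by apply/rowP => j; rewrite !mxE (negbTE iS).
  move=> x; rewrite ux dotpZl dotpZr mulrA -expr2 mulrC ler_wpM2l //.
  by rewrite -[leRHS]mul1r -ee cauchy_schwarz.
have := spectral_form_CS a lam_ge0 v u; rewrite -cE cu -/T => cs.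
(* Cauchy-Schwarz gives n2^2 <= T (n2 opt); combined with T <= 2 n this yields T^2 <= 4 n2 <= 4 T
   opt. *)
have n2T : n2 <= T * opt.
  have [->|nz] := eqVneq n2 0; first by rewrite mulr_ge0.
  have np : 0 < n2 by rewrite lt_def nz.
  rewrite -(ler_pM2l np) -expr2 (le_trans cs) // mulrCA ler_wpM2l //.
have [->|Tz] := eqVneq T 0; first by rewrite mulr_ge0.
have Tp : 0 < T by rewrite lt_def Tz.
rewrite -(ler_pM2l Tp) -expr2; apply: (@le_trans _ _ ((2 * n) ^+ 2)).
  by rewrite lerXn2r ?nnegrE ?mulr_ge0.
rewrite exprMn nn mulrCA (_ : 2 ^+ 2 = 4); last by ring.
by rewrite ler_wpM2l.
Qed.

Lemma CR2_form_le (V : 'M[R]_(d, r)) : CR2_set k V ->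
  form V V <= rho CR2 r ^+ 2 * opt.
Proof.
move=> [V1 _ Vl1 _]; rewrite spectral_form_col.
apply: (@le_trans _ _ (\sum_(i < r) 4 * opt)).
  apply: ler_sum => i _; apply: sparse_vector_form_le => //.
  by rewrite -l2norm_sqr.
rewrite sumr_const card_ord /rho exprMn sqr_sqrtr // -mulr_natr.
by rewrite le_eqVlt; apply/orP; left; apply/eqP; ring.
Qed.

End RelaxationBounds.

(** * Piecewise linear approximation *)

Section PiecewiseLinear.
Variables (R : realType) (N : nat) (t : R).
Hypothesis N_gt0 : (0 < N)%N.

Local Notation M := N.*2.

(** [gamma] with a plain natural index, so that l.+1 needs no bound. *)
Definition grid (l : nat) : R := (l%:R - N%:R) / N%:R * t.

Definition chord (l : nat) (x : R) : R :=
  (grid l + grid l.+1) * x - grid l * grid l.+1.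

(* SOS-II weights force xi to be the piecewise linear interpolant of the square
   on the grid; by convexity this is the maximum of its chords. *)
Definition square_pwl (x : R) : R :=
  \big[Num.max/chord 0 x]_(l <- iota 0 M) chord l x.

Let Nn0 : N%:R != 0 :> R.
Proof. by rewrite pnatr_eq0 -lt0n. Qed.

Lemma gridS l : grid l.+1 = grid l + t / N%:R.
Proof. by rewrite /grid -natr1; field. Qed.

(** No integer lies strictly between l and l + 1. *)
Lemma grid_chord_ge0 l m : 0 <= (grid m - grid l) * (grid m - grid l.+1).
Proof.
rewrite (_ : _ * _ = (t / N%:R) ^+ 2 * ((m%:R - l%:R) * (m%:R - l.+1%:R))).
  rewrite mulr_ge0 ?sqr_ge0 //; have [ml|lm] := leqP m l.
    have : m%:R <= l%:R :> R by rewrite ler_nat.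
    by rewrite -natr1; nra.
  have : l.+1%:R <= m%:R :> R by rewrite ler_nat.
  by rewrite -natr1; nra.
by rewrite /grid; field.
Qed.

Variable eta : 'I_(M.+1) -> R.
Hypothesis eta_sos : SOS2 eta.
Variable x : R.
Hypothesis xE : x = \sum_l gamma t l * eta l.

Let xi := \sum_l gamma t l ^+ 2 * eta l.

(** Averages a monic quadratic over the weights: (y - x)^2 yields Jensen, and the quadratic with
    roots at two neighbouring grid points yields the comparison with a chord. *)
Let eta_sum_quadratic (b c : R) :
  \sum_l (gamma t l ^+ 2 - b * gamma t l + c) * eta l = xi - b * x + c.
Proof.
have [_ e1 _ _] := eta_sos.
rewrite /xi xE mulr_sumr -sumrN -[c in RHS]mulr1 -e1 mulr_sumr -!big_split /=.
by apply: eq_bigr => l _; ring.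
Qed.

Lemma SOS2_sqr_le : x ^+ 2 <= xi.
Proof.
have := eta_sum_quadratic (2 * x) (x ^+ 2).
have : 0 <= \sum_l (gamma t l ^+ 2 - 2 * x * gamma t l + x ^+ 2) * eta l.
  apply: sumr_ge0 => l _; rewrite mulr_ge0 //; last by case: eta_sos.
  by rewrite (_ : _ + _ = (gamma t l - x) ^+ 2) ?sqr_ge0 //; ring.
by move=> h E; rewrite E in h; nra.
Qed.

Lemma SOS2_chord_le l : chord l x <= xi.
Proof.
have := eta_sum_quadratic (grid l + grid l.+1) (grid l * grid l.+1).
have : 0 <= \sum_m (gamma t m ^+ 2 - (grid l + grid l.+1) * gamma t m +
    grid l * grid l.+1) * eta m.
  apply: sumr_ge0 => m _; rewrite mulr_ge0 //; last by case: eta_sos.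
  rewrite (_ : _ + _ = (grid m - grid l) * (grid m - grid l.+1)).
    exact: grid_chord_ge0.
  by rewrite /gamma -/(grid m); ring.
by move=> h E; rewrite E in h; rewrite /chord; lra.
Qed.

Lemma SOS2_chord_eq : exists2 l, (l < M)%N & xi = chord l x.
Proof.
have [e0 e1 _ adj] := eta_sos.
have [l0 l0n lmin] : exists2 l, eta l != 0 & forall m, eta m != 0 -> (l <= m)%N.
  have [m mn] : exists m, eta m != 0.
    apply/existsP; rewrite -[X in is_true X]negbK negb_exists.
    apply/negP => /forallP z; move: e1; rewrite big1 => [/eqP|m _].
      by rewrite eq_sym oner_eq0.
    by apply/eqP; have := z m; rewrite negbK.
  pose P := [pred l | eta l != 0].
  by case: (arg_minnP (fun l : 'I__ => l : nat) (mn : P m)) => l; exists l.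
(* If all the weight sits on the last grid point, the segment must end there instead of starting
   there. *)
pose l := minn l0 M.-1.
have M0 : (0 < M)%N by rewrite double_gt0.
have lM : (l < M)%N by rewrite /l -[X in (_ < X)%N](prednK M0) ltnS geq_minr.
exists l => //.
have supp m : eta m != 0 -> m = l :> nat \/ m = l.+1 :> nat.
  move=> mn; have := lmin _ mn; rewrite leq_eqVlt => /orP[/eqP/esym E|lt].
    rewrite E /l; have := ltn_ord l0; rewrite ltnS leq_eqVlt => /orP[/eqP->|].
      by right; rewrite (minn_idPr (leq_pred _)) prednK.
    by move=> l0M; left; apply/esym/minn_idPl; rewrite -ltnS prednK.
  right; rewrite (adj _ _ lt l0n mn); congr S.
  rewrite /l; apply/esym/minn_idPl; rewrite -ltnS prednK //.
  by rewrite -ltnS (leq_ltn_trans _ (ltn_ord m)).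
have := eta_sum_quadratic (grid l + grid l.+1) (grid l * grid l.+1).
rewrite big1 => [|m _]; first by rewrite /chord => /eqP; rewrite eq_sym; lra.
have [->|mn] := eqVneq (eta m) 0; first by rewrite mulr0.
rewrite /gamma -/(grid m); case: (supp _ mn) => ->; ring.
Qed.

Lemma SOS2_square_pwl : xi = square_pwl x.
Proof.
apply: le_anti; apply/andP; split.
  have [l lM ->] := SOS2_chord_eq; rewrite /square_pwl.
  apply: (@Order.TotalTheory.le_bigmax_seq _ R _ (iota 0 M) (chord 0 x) l xpredT
    (fun l => chord l x)) => //.
  by rewrite mem_iota.
rewrite /square_pwl; elim/big_ind: _ => [|u v hu hv|l _].
- exact: SOS2_chord_le.
- by rewrite ge_max hu hv.
- exact: SOS2_chord_le.
Qed.

(** With g the left end and s the length of the segment, chord minus square is (x - g) (g + s - x)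
    <= s^2 / 4. *)
Lemma SOS2_le_sqr : xi <= x ^+ 2 + t ^+ 2 / (4 * N%:R ^+ 2).
Proof.
have [l _ ->] := SOS2_chord_eq; rewrite /chord gridS.
have -> : t ^+ 2 / (4 * N%:R ^+ 2) = (t / N%:R) ^+ 2 / 4 by field.
have := sqr_ge0 (2 * (x - grid l) - t / N%:R).
set g := grid l; set s := t / _; nra.
Qed.

End PiecewiseLinear.

Lemma SOS2_exists (R : realType) (N : nat) (t x : R) :
  (0 < N)%N -> 0 <= t -> `|x| <= t ->
  exists eta : 'I_(N.*2.+1) -> R, SOS2 eta /\ x = \sum_l gamma t l * eta l.
Proof.
move=> N0 t0; rewrite ler_norml => /andP[tx xt].
have Nn0 : N%:R != 0 :> R by rewrite pnatr_eq0 -lt0n.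
have M0 : (0 < N.*2)%N by rewrite double_gt0.
have g0 : grid N t 0 = - t by rewrite /grid; field.
have gM : grid N t N.*2 = t.
  by rewrite /grid -addnn natrD; field.
have ex : exists l, (l < N.*2)%N && (x <= grid N t l.+1).
  by exists N.*2.-1; rewrite prednK // leqnn gM.
case: (ex_minnP ex) => l /andP[lM xl] lmin.
have gl : grid N t l <= x.
  case: l lM xl lmin => [|l] lM xl lmin; first by rewrite g0.
  rewrite leNgt; apply/negP => /ltW xlt; have := lmin l.
  by rewrite (ltnW lM) xlt ltnn => /(_ isT).
have [c [c0 c1 cE]] : exists c, [/\ 0 <= c, c <= 1
    & x = (1 - c) * grid N t l + c * grid N t l.+1].
  (* When t = 0 all grid points coincide and the interpolation quotient is undefined. *)
  have [E|ne] := eqVneq (grid N t l) (grid N t l.+1).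
    by exists 0; split=> //; apply: le_anti; rewrite -E in xl *; rewrite mul0r subr0 mul1r addr0 xl gl.
  have lt : 0 < grid N t l.+1 - grid N t l.
    by rewrite subr_gt0 lt_def eq_sym ne (le_trans gl).
  exists ((x - grid N t l) / (grid N t l.+1 - grid N t l)); split.
  - by rewrite divr_ge0 ?subr_ge0 // ltW // -subr_gt0.
  - by rewrite ler_pdivrMr // mul1r lerD2r.
  - by field; rewrite gt_eqF.
have lM1 : (l < N.*2.+1)%N by rewrite ltnS ltnW.
pose i := Ordinal lM1; pose j : 'I_(N.*2.+1) := Ordinal (lM : (l.+1 < N.*2.+1)%N).
have ij : i != j by rewrite -val_eqE /= neq_ltn ltnSn.
pose eta m : R := if m == i then 1 - c else if m == j then c else 0.
have etaN m : m != i -> m != j -> eta m = 0 by rewrite /eta => /negbTE-> /negbTE->.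
have etai : eta i = 1 - c by rewrite /eta eqxx.
have etaj : eta j = c by rewrite /eta eq_sym (negbTE ij) eqxx.
have sumE (F : 'I_(N.*2.+1) -> R) : \sum_m F m * eta m = F i * (1 - c) + F j * c.
  rewrite (bigD1 i) //= (bigD1 j) 1?eq_sym //= etai etaj big1 ?addr0 //.
  by move=> m /andP[mi mj]; rewrite etaN ?mulr0.
exists eta; split; last first.
  by rewrite sumE cE /gamma /= /grid; ring.
have supp m : eta m != 0 -> m = i \/ m = j.
  rewrite /eta; case: (eqVneq m i) => [->|_]; first by left.
  by case: (eqVneq m j) => [->|_]; [right|rewrite eqxx].
split.
- by move=> m; rewrite /eta; case: ifP => _; [rewrite subr_ge0|case: ifP].
- by have := sumE (fun=> 1); under eq_bigr do rewrite mul1r; move=> ->; ring.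
- apply: leq_trans (_ : #|[set i; j]%SET| <= 2)%N; last by rewrite cards2; case: (_ != _).
  apply/subset_leq_card/fintype.subsetP => m; rewrite !inE => /supp[]->; rewrite eqxx ?orbT //.
- move=> m1 m2 lt12 /supp h1 /supp h2; move: lt12.
  case: h1 => ->; case: h2 => -> /=; rewrite ?ltnn // => lt.
  by have := ltn_trans lt (ltnSn l); rewrite ltnn.
Qed.

(** * Feasible points and attainment *)

Section SparseVectors.
Variable R : realType.

(* Compare both sides with the sum of the excesses over the k-th largest square. *)
Lemma sum_sqr_le_top_entries d k (x : 'cV[R]_d) (S : {set 'I_d}) :
  (0 < k <= d)%N -> (#|S| <= k)%N ->
  \sum_(i in S) x i 0 ^+ 2 <= l2norm (top_entries k x) ^+ 2.
Proof.
move=> /andP[k0 kd] Sk; set l := [seq x i 0 | i <- enum 'I_d].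
pose s := sort (fun s t : R => `|t| <= `|s|) l.
have sz : size s = d by rewrite size_sort size_map size_enum_ord.
pose c := nth 0 s k.-1 ^+ 2; pose pos (z : R) := Num.max 0 z.
have c0 : 0 <= c by exact: sqr_ge0.
have nth_le i j : (i <= j)%N -> (j < d)%N -> nth 0 s j ^+ 2 <= nth 0 s i ^+ 2.
  move=> ij jd; rewrite -[leLHS]real_normK ?num_real // -[leRHS]real_normK ?num_real //.
  rewrite lerXn2r ?nnegrE //.
  have := @sorted_leq_nth _ (fun s t : R => `|t| <= `|s|) _ _ 0 s _ i j.
  apply; rewrite ?inE ?sz ?(leq_ltn_trans ij) //.
    by move=> u v w h1 h2; apply: le_trans h2 h1.
  by apply: sort_sorted => u v; exact: le_total.
have E : \sum_i pos (x i 0 ^+ 2 - c) = \sum_(i < k) (nth 0 s i ^+ 2 - c).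
  have -> : \sum_i pos (x i 0 ^+ 2 - c) = \sum_(y <- l) pos (y ^+ 2 - c).
    by rewrite big_map big_enum.
  have pl : perm_eq l s by rewrite perm_sym perm_sort.
  rewrite (perm_big s pl) /=.
  rewrite (big_nth 0) sz (big_cat_nat (n := k)) //= [X in _ + X]big_nat_cond.
  rewrite [X in _ + X]big1 => [|i /andP[/andP[ki id] _]]; last first.
    by apply/max_idPl; rewrite subr_le0 nth_le // (leq_trans (leq_pred k)).
  rewrite addr0 big_mkord; apply: eq_bigr => i _.
  apply/max_idPr; rewrite subr_ge0 nth_le //; last by rewrite prednK.
  by rewrite -ltnS prednK.
have -> : l2norm (top_entries k x) ^+ 2 = k%:R * c + \sum_i pos (x i 0 ^+ 2 - c).
  rewrite l2norm_sqr E sumrB sumr_const card_ord mulr_natl addrC subrK.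
  by apply: eq_bigr => i _; rewrite !mxE expr2.
apply: (@le_trans _ _ (\sum_(i in S) (c + pos (x i 0 ^+ 2 - c)))).
  apply: ler_sum => i _; have : x i 0 ^+ 2 - c <= pos (x i 0 ^+ 2 - c).
    by rewrite le_max lexx orbT.
  lra.
rewrite big_split /= sumr_const lerD //.
  by rewrite mulr_natl ler_wpMn2l.
rewrite [leRHS](bigID (fun i => i \in S)) /= lerDl sumr_ge0 // => i _.
by rewrite le_max lexx.
Qed.

Lemma dotp_sparse_sqr_le d (x y : 'cV[R]_d) (S : {set 'I_d}) :
  (forall i, i \notin S -> y i 0 = 0) ->
  dotp x y ^+ 2 <= (\sum_(i in S) x i 0 ^+ 2) * dotp y y.
Proof.
move=> yS; pose u := \col_i (if i \in S then x i 0 else 0).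
have -> : dotp x y = dotp u y.
  apply: eq_bigr => i _; rewrite mxE; case: (boolP (i \in S)) => // /yS->.
  by rewrite !mulr0.
suff -> : \sum_(i in S) x i 0 ^+ 2 = dotp u u by exact: cauchy_schwarz.
rewrite big_mkcond; apply: eq_bigr => i _; rewrite mxE expr2.
by case: ifP; rewrite ?mul0r.
Qed.

Lemma sparse_dotp_le_theta d k (a : 'I_d -> 'cV[R]_d) j (y : 'cV[R]_d) (S : {set 'I_d}) :
  (0 < k <= d)%N -> (#|S| <= k)%N -> (forall i, i \notin S -> y i 0 = 0) ->
  dotp y y <= 1 -> `|dotp (a j) y| <= theta k a j.
Proof.
move=> kd Sk yS y1; rewrite -(@ler_pXn2r _ 2) ?nnegrE ?l2norm_ge0 //.
rewrite real_normK ?num_real //; apply: le_trans (dotp_sparse_sqr_le _ yS) _.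
apply: le_trans (sum_sqr_le_top_entries (a j) kd Sk).
by rewrite ler_piMr // sumr_ge0 // => i _; rewrite sqr_ge0.
Qed.

Lemma l1norm_sparse_le d k (y : 'cV[R]_d) (S : {set 'I_d}) :
  (#|S| <= k)%N -> (forall i, i \notin S -> y i 0 = 0) ->
  l1norm y <= Num.sqrt k%:R * l2norm y.
Proof.
move=> Sk yS; rewrite -(@ler_pXn2r _ 2) ?nnegrE ?mulr_ge0 ?l1norm_ge0 ?sqrtr_ge0 //.
rewrite exprMn sqr_sqrtr // l2norm_sqr.
pose u : 'cV[R]_d := \col_i `|y i 0|.
have uS i : i \notin S -> u i 0 = 0 by move=> /yS yi; rewrite mxE yi normr0.
have -> : l1norm y = dotp (const_mx 1) u.
  by apply: eq_bigr => i _; rewrite !mxE mul1r.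
have -> : dotp y y = dotp u u.
  by apply: eq_bigr => i _; rewrite !mxE -!expr2 real_normK ?num_real.
apply: le_trans (dotp_sparse_sqr_le _ uS) _; rewrite ler_wpM2r ?dotp_ge0 //.
rewrite (eq_bigr (fun=> 1)) => [|i _]; last by rewrite mxE expr1n.
by rewrite sumr_const ler_nat.
Qed.

End SparseVectors.

Section Feasible.
Variables (R : realType) (d k r : nat) (V : 'M[R]_(d, r)).
Hypotheses (r_gt0 : (0 < r)%N) (FV : feasible k V).

Let S : {set 'I_d} := [set i | row i V != 0]%SET.

Let VV : V^T *m V = 1%:M. Proof. by case: FV. Qed.

Let Sk : (#|S| <= k)%N.
Proof. by case: FV => _; rewrite cardsE. Qed.

Let VS i j : i \notin S -> V i j = 0.
Proof. by rewrite inE negbK => /eqP/rowP/(_ j); rewrite !mxE. Qed.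

Let VxS (x : 'cV[R]_r) i : i \notin S -> (V *m x) i 0 = 0.
Proof. by move=> iS; rewrite mxE big1 // => j _; rewrite VS // mul0r. Qed.

Let Viso (x : 'cV[R]_r) : dotp (V *m x) (V *m x) = dotp x x.
Proof. by rewrite dotp_mulmx mulmxA VV mul1mx. Qed.

Lemma feasible_col_dotp i j : dotp (col i V) (col j V) = (i == j)%:R.
Proof.
have /matrixP/(_ i j) := VV; rewrite !mxE => <-.
by apply: eq_bigr => l _; rewrite !mxE.
Qed.

Lemma feasible_theta a i j : (0 < k <= d)%N ->
  `|dotp (a j) (col i V)| <= theta k a j.
Proof.
move=> kd; apply: (sparse_dotp_le_theta _ _ kd Sk) => [l lS|].
  by rewrite mxE VS.
by rewrite feasible_col_dotp eqxx.
Qed.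

Let row_sum : sum_row_norms V <= Num.sqrt (r * k)%:R.
Proof.
pose n : 'cV[R]_d := \col_i l2norm (row i V)^T.
have -> : sum_row_norms V = l1norm n.
  by apply: eq_bigr => i _; rewrite mxE ger0_norm ?l2norm_ge0.
apply: le_trans (l1norm_sparse_le Sk _) _ => [i|].
  rewrite inE negbK => /eqP h.
  by rewrite mxE h trmx0 l2normE dotp0r sqrtr0.
rewrite l2normE -sqrtrM // ler_wsqrtr // mulrC natrM ler_wpM2r //.
have -> : dotp n n = \sum_j dotp (col j V) (col j V).
  rewrite /dotp exchange_big; apply: eq_bigr => i _; rewrite !mxE -expr2 l2norm_sqr.
  by apply: eq_bigr => j _; rewrite !mxE.
rewrite (eq_bigr (fun=> 1)) => [|j _]; last by rewrite feasible_col_dotp eqxx.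
by rewrite sumr_const card_ord.
Qed.

Lemma feasible_CR c : CR_set c k V.
Proof.
case: c => /=.
- split=> //.
    by apply/(norm_op_le1 _ r_gt0) => x; rewrite Viso.
  apply/(norm_2to1_le _ _ r_gt0) => x.
  apply: le_trans (l1norm_sparse_le Sk (@VxS x)) _.
  by rewrite !l2normE Viso.
- pose h : 'rV[R]_d := \row_i (i \in S)%:R.
  have Vx y x : dotp y (diag_mx h *m y) + 2 * dotp y (V *m x) + dotp x x =
      \sum_i (i \in S)%:R * (y i 0 + (V *m x) i 0) ^+ 2.
    rewrite -Viso mulr_sumr -!big_split; apply: eq_bigr => i _ /=.
    rewrite mul_diag_mx mxE [h _ _]mxE.
    by case: (boolP (i \in S)) => [_|/VxS->] /=; ring.
  exists h; split=> //.
  + by move=> i; rewrite mxE.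
  + rewrite (eq_bigr (fun i => (i \in S)%:R)) => [|i _]; last by rewrite mxE.
    rewrite -natr_sum -big_mkcond sum1_card.
    apply: (@le_trans _ _ k%:R); first by rewrite ler_nat.
    by rewrite ler_peMl // half_pi_ge1.
  + apply/psd_block_form => [|y x]; first by rewrite trmx1.
    have := dotp_ge0 (y + V *m x).
    by rewrite mul1mx dotpDl !dotpDr Viso (dotpC (V *m x)); lra.
  + apply/psd_block_form => [|y x]; first by rewrite tr_diag_mx.
    by rewrite Vx sumr_ge0 // => i _; rewrite mulr_ge0 ?sqr_ge0.
- split=> //.
  + by move=> j; rewrite l2norm_sqr feasible_col_dotp eqxx.
  + move=> i j ij; rewrite !l2norm_sqr -scaleN1r !dotpDl !dotpDr !dotpZl !dotpZr.
    rewrite !feasible_col_dotp !eqxx (eq_sym j) (negbTE ij) /=; split; lra.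
  + move=> j; apply: le_trans (l1norm_sparse_le Sk _) _ => [i iS|].
      by rewrite mxE VS.
    by rewrite l2normE feasible_col_dotp eqxx sqrtr1 mulr1.
Qed.

End Feasible.

(** * Closedness of the constraint sets and existence of maximisers *)

Section Attainment.
Local Open Scope classical_set_scope.
Variables (R : realType) (d r : nat).

Lemma continuous_bigmax m n (I : Type) (s : seq I) (f0 : 'M[R]_(m, n) -> R)
    (F : I -> 'M[R]_(m, n) -> R) :
  continuous f0 -> (forall i, continuous (F i)) ->
  continuous (fun M => \big[Num.max/f0 M]_(i <- s) F i M).
Proof.
move=> c0 cF; elim: s => [|i s IH].
  by rewrite (_ : (fun M => _) = f0) //; apply/funext => M; rewrite big_nil.
rewrite (_ : (fun M => _) = (fun M => Num.max (F i M)
    (\big[Num.max/f0 M]_(j <- s) F j M))); first exact: continuous_maxr.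
by apply/funext => M; rewrite big_cons.
Qed.

Lemma continuous_dotp_col (y : 'cV[R]_d) i :
  continuous (fun V : 'M[R]_(d, r) => dotp y (col i V)).
Proof.
apply: continuous_sum => l; apply: continuous_mul; first exact: continuous_const.
rewrite (_ : (fun V => _) = (fun V : 'M[R]_(d, r) => V l i)).
  exact: continuous_entry.
by apply/funext => V; rewrite mxE.
Qed.

Lemma continuous_mulmx_entry (x : 'cV[R]_r) i :
  continuous (fun V : 'M[R]_(d, r) => (V *m x) i 0).
Proof.
rewrite (_ : (fun V => _) = (fun V : 'M[R]_(d, r) => \sum_j V i j * x j 0)).
  apply: continuous_sum => j; apply: continuous_mul; first exact: continuous_entry.
  exact: continuous_const.
by apply/funext => V; rewrite mxE.
Qed.

Lemma continuous_dotp_mulmx y (x : 'cV[R]_r) :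
  continuous (fun V : 'M[R]_(d, r) => dotp y (V *m x)).
Proof.
apply: continuous_sum => l; apply: continuous_mul; first exact: continuous_const.
exact: continuous_mulmx_entry.
Qed.

Lemma continuous_sqnorm_mulmx (x : 'cV[R]_r) :
  continuous (fun V : 'M[R]_(d, r) => dotp (V *m x) (V *m x)).
Proof.
by apply: continuous_sum => l; apply: continuous_mul; apply: continuous_mulmx_entry.
Qed.

Lemma continuous_l1norm_mulmx (x : 'cV[R]_r) :
  continuous (fun V : 'M[R]_(d, r) => l1norm (V *m x)).
Proof.
by apply: continuous_sum => l; apply: continuous_abs; apply: continuous_mulmx_entry.
Qed.

Lemma continuous_sum_row_norms : continuous (fun V : 'M[R]_(d, r) => sum_row_norms V).
Proof.
apply: continuous_sum => i; apply: continuous_sqrt; apply: continuous_sum => j.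
rewrite (_ : (fun V => _) = (fun V : 'M[R]_(d, r) => V i j * V i j)).
  by apply: continuous_mul; apply: continuous_entry.
by apply/funext => V; rewrite !mxE expr2.
Qed.

Lemma continuous_l2norm_mulmx_sqr (y : 'cV[R]_r) : 
  continuous (fun V : 'M[R]_(d, r) => l2norm (V *m y) ^+ 2).
Proof.
rewrite (_ : (fun V => _) = (fun V : 'M[R]_(d, r) => dotp (V *m y) (V *m y))).
  exact: continuous_sqnorm_mulmx.
by apply/funext => V; rewrite l2norm_sqr.
Qed.

Lemma contraction_entry_le1 (V : 'M[R]_(d, r)) :
  (forall x, dotp (V *m x) (V *m x) <= dotp x x) -> forall i j, `|V i j| <= 1.
Proof.
move=> Vop i j; rewrite -(@expr_le1 _ 2) // real_normK ?num_real //.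
pose e : 'cV[R]_r := delta_mx j 0.
have <- : dotp e e = 1.
  rewrite /dotp (bigD1 j) //= big1 => [|l /negbTE lj].
    by rewrite mxE !eqxx mulr1 addr0.
  by rewrite mxE lj mul0r.
apply: le_trans (Vop e); apply: le_trans (sqr_entry_le_dotp _ i).
by rewrite -colE mxE.
Qed.

(** Row sparsity is a finite union, over supports of size at most k, of linear subspaces. *)
Lemma closed_feasible k : closed (@feasible R k r d).
Proof.
have -> : @feasible R k r d = [set V : 'M[R]_(d, r) |
    (forall ij : 'I_r * 'I_r, \sum_l V l ij.1 * V l ij.2 = (ij.1 == ij.2)%:R) /\
    (\bigcup_(S in [set S : {set 'I_d} | (#|S| <= k)%N])
      [set W : 'M[R]_(d, r) | forall ij : 'I_d * 'I_r, ij.1 \notin S -> W ij.1 ij.2 = 0]) V].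
  apply/seteqP; split => V /= [h hk]; split.
  - move=> [i j]; move/matrixP/(_ i j): h; rewrite !mxE => <-.
    by apply: eq_bigr => l _; rewrite mxE.
  - exists [set i | row i V != 0]%SET; first by rewrite /= cardsE.
    move=> [i j] /=; rewrite inE negbK => /eqP/rowP/(_ j).
    by rewrite !mxE.
  - apply/matrixP => i j; have := h (i, j); rewrite !mxE /= => <-.
    by apply: eq_bigr => l _; rewrite mxE.
  - have [S /= Sk VS] := hk; apply: leq_trans Sk; apply/subset_leq_card/fintype.subsetP.
    move=> i; rewrite inE; apply: contraR => iS; apply/eqP/rowP => j.
    by rewrite !mxE; apply: (VS (i, j)).
apply: closed_and.
  apply: closed_all => ij; apply: closed_eq_cst; apply: continuous_sum => l.
  by apply: continuous_mul; apply: continuous_entry.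
apply: closed_bigcup => [|S _]; first exact: finite_finset.
apply: closed_all => ij; apply: closed_imply.
by apply: closed_eq_cst; apply: continuous_entry.
Qed.

(** Operator norms, being suprema, are unfolded into families of closed conditions indexed by test
    vectors. Q stands for the constraint |g| <= theta. *)
Lemma CR_attained c k (Q : 'M[R]_(d, r) -> Prop) (f : 'M[R]_(d, r) -> R) :
  (0 < r)%N -> closed [set V | Q V] -> continuous f ->
  (exists V, CR_set c k V /\ Q V) ->
  exists2 V, CR_set c k V /\ Q V & forall W, CR_set c k W /\ Q W -> f W <= f V.
Proof.
move=> r0 cQ cf ne.
case: c ne => ne.
- apply: (@max_on_closed_bounded R d r [set V | CR1_set k V /\ Q V] f 1) => //.
    apply: closed_and cQ.
    rewrite (_ : [set V | _] = [set V : 'M[R]_(d, r) |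
      (forall x, dotp (V *m x) (V *m x) <= dotp x x) /\
      (forall x, l1norm (V *m x) <= Num.sqrt k%:R * l2norm x) /\
      sum_row_norms V <= Num.sqrt (r * k)%:R]).
      apply: closed_and; last apply: closed_and.
      + by apply: closed_all => x; apply: closed_le_cst; apply: continuous_sqnorm_mulmx.
      + by apply: closed_all => x; apply: closed_le_cst; apply: continuous_l1norm_mulmx.
      + by apply: closed_le_cst; apply: continuous_sum_row_norms.
    apply/seteqP; split => V /=.
      by move=> [/(norm_op_le1 _ r0) h1 /(norm_2to1_le _ _ r0) h2 h3].
    move=> [h1 [h2 h3]]; split=> //; first exact/(norm_op_le1 _ r0).
    exact/(norm_2to1_le _ _ r0).
  by move=> V /= [[/(norm_op_le1 _ r0) h _ _] _]; apply: contraction_entry_le1.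
(* CR1' is a projection, so the maximum is taken over pairs (V, h), with h stored as an extra
   column; h is bounded by its sum. *)
- pose K (M : 'M[R]_(d, r + 1)) :=
    [/\ forall i, 0 <= rsubmx M i 0, sum_row_norms (lsubmx M) <= Num.sqrt (r * k)%:R,
      \sum_i rsubmx M i 0 <= pi / 2 * k%:R,
      forall yx : 'cV[R]_d * 'cV[R]_r,
        0 <= dotp yx.1 yx.1 + 2 * dotp yx.1 (lsubmx M *m yx.2) + dotp yx.2 yx.2
    & forall yx : 'cV[R]_d * 'cV[R]_r,
        0 <= \sum_i rsubmx M i 0 * yx.1 i 0 ^+ 2
             + 2 * dotp yx.1 (lsubmx M *m yx.2) + dotp yx.2 yx.2].
  have KE V : CR1'_set k V <-> exists h, K (row_mx V h).
    have diagE (h : 'cV[R]_d) y : dotp y (diag_mx h^T *m y) = \sum_i h i 0 * y i 0 ^+ 2.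
      by apply: eq_bigr => i _; rewrite mul_diag_mx !mxE; ring.
    split=> [[h [h0 hrow hsum hop hh]]|[h]].
      exists h^T; split; rewrite ?row_mxKl ?row_mxKr //.
      + by move=> i; rewrite mxE.
      + by rewrite (eq_bigr (h 0)) // => i _; rewrite mxE.
      + move=> [y x]; move/psd_block_form: hop => /(_ (trmx1 _ _) y x).
        by rewrite mul1mx.
      + move=> [y x]; move/psd_block_form: hh => /(_ (tr_diag_mx _) y x).
        by rewrite -[h]trmxK diagE trmxK.
    move=> [h0 hrow hsum hop hh]; rewrite ?row_mxKl ?row_mxKr in h0 hrow hsum hop hh.
    exists h^T; split => //.
    + by move=> i; rewrite mxE.
    + by rewrite (eq_bigr (fun i => h i 0)) // => i _; rewrite mxE.
    + apply/psd_block_form => [|y x]; first by rewrite trmx1.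
      by rewrite mul1mx; exact: hop (y, x).
    + apply/psd_block_form => [|y x]; first by rewrite tr_diag_mx.
      by rewrite diagE; exact: hh (y, x).
  have clsub : continuous (fun M : 'M[R]_(d, r + 1) => lsubmx M).
    move=> M s /= /nbhs_ballP[e e0 es]; apply/nbhs_ballP; exists e => // M' [_ MM].
    by apply: es; split=> // i j; rewrite !mxE; apply: MM.
  have clc (g : 'M[R]_(d, r) -> R) : continuous g ->
      continuous (fun M : 'M[R]_(d, r + 1) => g (lsubmx M)).
    by move=> cg M; apply: (@continuous_comp _ _ _ (fun M : 'M[R]_(d, r + 1) => lsubmx M) g); [exact: clsub|exact: cg].
  have crs i : continuous (fun M : 'M[R]_(d, r + 1) => rsubmx M i 0).
    rewrite (_ : (fun M => _) = (fun M : 'M[R]_(d, r + 1) => M i (rshift r 0))).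
      exact: continuous_entry.
    by apply/funext => M; rewrite mxE.
  have ge_closed (g : 'M[R]_(d, r + 1) -> R) : continuous g -> closed [set M | 0 <= g M].
    move=> cg; apply: (@closed_comp _ _ g [set x | 0 <= x]); last exact: closed_ge.
    by move=> M _; exact: cg.
  have [||||M [KM QM] Mmax] := @max_on_closed_bounded R d (r + 1)
      [set M | K M /\ Q (lsubmx M)] (fun M => f (lsubmx M)) (1 + pi / 2 * k%:R).
  + have [V [/KE[h Kh] QV]] := ne; exists (row_mx V h).
    by split=> //; rewrite row_mxKl.
  + apply: closed_and; last first.
      apply: (@closed_comp _ _ (fun M : 'M[R]_(d, r + 1) => lsubmx M) [set V | Q V]); last exact: cQ.
      by move=> M _; exact: clsub.
    rewrite (_ : [set M | K M] = [set M |
      (forall i, 0 <= rsubmx M i 0) /\ (sum_row_norms (lsubmx M) <= Num.sqrt (r * k)%:R /\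
      (\sum_i rsubmx M i 0 <= pi / 2 * k%:R /\
      ((forall yx : 'cV[R]_d * 'cV[R]_r,
        0 <= dotp yx.1 yx.1 + 2 * dotp yx.1 (lsubmx M *m yx.2) + dotp yx.2 yx.2) /\
       (forall yx : 'cV[R]_d * 'cV[R]_r,
        0 <= \sum_i rsubmx M i 0 * yx.1 i 0 ^+ 2
             + 2 * dotp yx.1 (lsubmx M *m yx.2) + dotp yx.2 yx.2))))]); last first.
      apply/seteqP; split => M /=; first by case.
      by move=> [? [? [? []]]].
    apply: closed_and; first by apply: closed_all => i; apply: ge_closed.
    apply: closed_and.
      by apply: closed_le_cst; apply: (clc (@sum_row_norms R r d)); apply: continuous_sum_row_norms.
    apply: closed_and; first by apply: closed_le_cst; apply: continuous_sum.
    apply: closed_and; apply: closed_all => -[y x] /=; apply: ge_closed.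
      apply: continuous_add; last exact: continuous_const.
      apply: continuous_add; first exact: continuous_const.
      apply: continuous_mul; first exact: continuous_const.
      by apply: (clc (fun V => dotp y (V *m x))); apply: continuous_dotp_mulmx.
    apply: continuous_add; last exact: continuous_const.
    apply: continuous_add.
      apply: continuous_sum => i; apply: continuous_mul => //; exact: continuous_const.
    apply: continuous_mul; first exact: continuous_const.
    by apply: (clc (fun V => dotp y (V *m x))); apply: continuous_dotp_mulmx.
  + move=> M [[h0 _ hsum hop _] _] i j.
    have p0 : 0 <= pi / 2 * k%:R :> R.
      by rewrite mulr_ge0 // (le_trans _ (half_pi_ge1 R)).
    rewrite -(hsubmxK M) mxE; case: splitP => l _.
      apply: le_trans (contraction_entry_le1 _ _ _) _; last by rewrite lerDl.
      move=> x; have := hop (- (lsubmx M *m x), x).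
      by rewrite /= -scaleN1r !dotpZl !dotpZr; lra.
    rewrite ord1 ger0_norm //; apply: le_trans (_ : _ <= pi / 2 * k%:R) _; last first.
      by rewrite lerDr.
    by apply: le_trans hsum; rewrite (bigD1 i) //= lerDl sumr_ge0.
  + exact: clc.
  exists (lsubmx M).
    by split=> //; apply/KE; exists (rsubmx M); rewrite hsubmxK.
  move=> W [/KE[h Kh] QW]; have := Mmax (row_mx W h); rewrite /= row_mxKl; exact.
- apply: (@max_on_closed_bounded R d r [set V | CR2_set k V /\ Q V] f 1) => //.
    have colE (j : 'I_r) (V : 'M[R]_(d, r)) : col j V = V *m delta_mx j 0 by rewrite -colE.
    apply: closed_and cQ.
    rewrite (_ : [set V | _] = [set V : 'M[R]_(d, r) |
      (forall j, l2norm (V *m delta_mx j 0) ^+ 2 <= 1) /\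
      ((forall jj : 'I_r * 'I_r, jj.1 != jj.2 ->
         l2norm (V *m (delta_mx jj.1 0 + delta_mx jj.2 0)) ^+ 2 <= 2 /\
         l2norm (V *m (delta_mx jj.1 0 - delta_mx jj.2 0)) ^+ 2 <= 2) /\
      ((forall j, l1norm (V *m delta_mx j 0) <= Num.sqrt k%:R) /\
        sum_row_norms V <= Num.sqrt (r * k)%:R))]); last first.
      apply/seteqP; split => V /=.
        move=> [h1 h2 h3 h4]; split; [|split; [|split]] => //.
        + by move=> j; rewrite -colE.
        + by move=> [i j] /= ij; rewrite mulmxDr mulmxBr -!colE; exact: h2.
        + by move=> j; rewrite -colE.
      move=> [h1 [h2 [h3 h4]]]; split => //.
      + by move=> j; rewrite colE.
      + by move=> i j ij; rewrite !colE -mulmxDr -mulmxBr; exact: (h2 (i, j)).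
      + by move=> j; rewrite colE.
    apply: closed_and; first by apply: closed_all => j; apply: closed_le_cst; apply: continuous_l2norm_mulmx_sqr.
    apply: closed_and.
      by apply: closed_all => jj; apply: closed_imply; apply: closed_and;
        apply: closed_le_cst; apply: continuous_l2norm_mulmx_sqr.
    apply: closed_and; first by apply: closed_all => j; apply: closed_le_cst; apply: continuous_l1norm_mulmx.
    by apply: closed_le_cst; apply: continuous_sum_row_norms.
  move=> V /= [[h _ _ _] _] i j; rewrite -(@expr_le1 _ 2) // real_normK ?num_real //.
  apply: le_trans (h j); rewrite l2norm_sqr; apply: le_trans (sqr_entry_le_dotp _ i).
  by rewrite mxE.
Qed.

End Attainment.

(** * The convex integer program *)

Section ConvexIntegerProgram.
Variables (R : realType) (d k r N : nat) (lam : 'I_d -> R) (a : 'I_d -> 'cV[R]_d).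
Hypotheses (N_gt0 : (0 < N)%N) (r_gt0 : (0 < r)%N).
Hypotheses (rk : (r <= k)%N) (kd : (k <= d)%N).
Hypothesis lam_ge0 : forall j, 0 <= lam j.

Local Notation form := (spectral_form lam a).

Let theta_ge0 j : 0 <= theta k a j.
Proof. exact: l2norm_ge0. Qed.

Definition cip_objective (V : 'M[R]_(d, r)) : R :=
  \sum_j lam j * \sum_i square_pwl N (theta k a j) (dotp (a j) (col i V)).

Definition within_theta (V : 'M[R]_(d, r)) : Prop :=
  forall ij : 'I_r * 'I_d, `|dotp (a ij.2) (col ij.1 V)| <= theta k a ij.2.

(** Eliminates g, xi and eta: the weights exist as soon as |g| <= theta, and xi does not depend on
    their choice. *)
Lemma CIP_valuesP c v :
  CIP_values c N k r lam a v <->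
  exists V, (CR_set c k V /\ within_theta V) /\ v = cip_objective V.
Proof.
split=> [[V [g [xi [eta [cV pla ->]]]]]|[V [[cV tV] ->]]].
  exists V; split; first split=> // -[i j] /=.
    by have [gE _ _ _] := pla j i; rewrite gE dotpE.
  apply: eq_bigr => j _; congr (_ * _); apply: eq_bigr => i _.
  have [gE gS xiE sos _] := pla j i.
  by rewrite xiE (SOS2_square_pwl N_gt0 sos gS) gE dotpE.
have /choice[eta etaP] (ij : 'I_r * 'I_d) := SOS2_exists N_gt0 (theta_ge0 ij.2) (tV ij).
pose g := \matrix_(j < d, i < r) dotp (a j) (col i V).
pose xi := \matrix_(j < d, i < r) square_pwl N (theta k a j) (dotp (a j) (col i V)).
exists V, g, xi, (fun j i => eta (i, j)); split=> // [j i|].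
  have [sos gS] := etaP (i, j); rewrite [g j i]mxE [xi j i]mxE dotpE.
  split=> //; last exact: (tV (i, j)).
  by rewrite (SOS2_square_pwl N_gt0 sos gS).
apply: eq_bigr => j _; congr (_ * _); apply: eq_bigr => i _.
by rewrite mxE.
Qed.

Let pwl_bounds V : within_theta V -> forall i j x,
  x = dotp (a j) (col i V) ->
  x ^+ 2 <= square_pwl N (theta k a j) x <=
  x ^+ 2 + theta k a j ^+ 2 / (4 * N%:R ^+ 2).
Proof.
move=> tV i j _ ->; have [eta [sos xE]] := SOS2_exists N_gt0 (theta_ge0 j) (tV (i, j)).
rewrite -(SOS2_square_pwl N_gt0 sos xE).
by rewrite (SOS2_sqr_le sos xE) (SOS2_le_sqr N_gt0 sos xE).
Qed.

Let formE (V : 'M[R]_(d, r)) :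
  form V V = \sum_j lam j * \sum_i dotp (a j) (col i V) ^+ 2.
Proof.
apply: eq_bigr => j _; congr (_ * _); apply: eq_bigr => i _.
rewrite expr2 (_ : (V^T *m a j) i 0 = dotp (a j) (col i V)) //.
by rewrite mxE; apply: eq_bigr => l _; rewrite !mxE mulrC.
Qed.

Lemma form_le_cip V : within_theta V -> form V V <= cip_objective V.
Proof.
move=> tV; rewrite formE; apply: ler_sum => j _; rewrite ler_wpM2l //.
by apply: ler_sum => i _; case/andP: (pwl_bounds tV (erefl (dotp (a j) (col i V)))).
Qed.

Lemma cip_le_form V : within_theta V ->
  cip_objective V <= form V V +
    \sum_j (r%:R * theta k a j ^+ 2 * lam j) / (4 * N%:R ^+ 2).
Proof.
move=> tV; rewrite formE -big_split; apply: ler_sum => j _ /=.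
have -> : r%:R * theta k a j ^+ 2 * lam j / (4 * N%:R ^+ 2) =
    lam j * \sum_(i < r) theta k a j ^+ 2 / (4 * N%:R ^+ 2).
  by rewrite sumr_const card_ord -mulr_natl; ring.
rewrite -mulrDr ler_wpM2l // -big_split; apply: ler_sum => i _ /=.
by case/andP: (pwl_bounds tV (erefl (dotp (a j) (col i V)))).
Qed.

Lemma continuous_cip_objective : continuous cip_objective.
Proof.
apply: continuous_sum => j; apply: continuous_mul; first exact: continuous_const.
apply: continuous_sum => i.
have cc l : continuous (fun V : 'M[R]_(d, r) =>
    chord N (theta k a j) l (dotp (a j) (col i V))).
  apply: continuous_add; last exact: continuous_const.
  apply: continuous_mul; first exact: continuous_const.
  exact: continuous_dotp_col.
exact: continuous_bigmax.
Qed.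

Lemma continuous_form : continuous (fun V : 'M[R]_(d, r) => form V V).
Proof.
rewrite (_ : (fun V => _) = (fun V : 'M[R]_(d, r) =>
    \sum_j lam j * \sum_i dotp (a j) (col i V) * dotp (a j) (col i V))).
  apply: continuous_sum => j; apply: continuous_mul; first exact: continuous_const.
  by apply: continuous_sum => i; apply: continuous_mul; apply: continuous_dotp_col.
by apply/funext => V; rewrite formE.
Qed.

Lemma closed_within_theta : closed [set V | within_theta V]%classic.
Proof.
apply: closed_all => ij; apply: closed_le_cst; apply: continuous_abs.
exact: continuous_dotp_col.
Qed.

Lemma feasible_sparse (V : 'M[R]_(d, r)) (S : {set 'I_d}) : V^T *m V = 1%:M ->
  #|S| = k -> (forall i, i \notin S -> row i V = 0) -> feasible k V.
Proof.
move=> VV Sk VS; split=> //; rewrite -Sk; apply/subset_leq_card/fintype.subsetP => i.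
by rewrite inE; apply: contraR => /VS->.
Qed.

Let rkd : (r <= k <= d)%N. Proof. by rewrite rk. Qed.

Lemma form_attained : exists2 V : 'M[R]_(d, r), feasible k V &
  forall W : 'M[R]_(d, r), feasible k W -> form W W <= form V V.
Proof.
apply: (@max_on_closed_bounded R d r (@feasible R k r d) _ 1).
(* Applied to the zero matrix, [sparse_form_le] still produces an orthonormal sparse V, so the
   feasible set is non-empty. *)
- have [||||V [S [VV Sk VS _]]] :=
      @sparse_form_le R d lam a lam_ge0 r k 0 finset.set0 0 rkd.
  + by rewrite cards0.
  + by move=> i _; apply/rowP => j; rewrite !mxE.
  + by [].
  + by move=> x; rewrite mul0mx dotp0r mul0r.
  by exists V; apply: feasible_sparse Sk VS.
- exact: closed_feasible.
- move=> V [VV _]; apply: contraction_entry_le1 => x.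
  by rewrite dotp_mulmx mulmxA VV mul1mx.
- exact: continuous_form.
Qed.

End ConvexIntegerProgram.

Theorem theorem4 (R : realType) (d k r N : nat)
    (hN : (0 < N)%N) (hr : (1 <= r)%N) (hrk : (r <= k)%N) (hkd : (k <= d)%N)
    (A : 'M[R]_d) (hA : sample_covariance A)
    (lambda : 'I_d -> R) (a : 'I_d -> 'cV[R]_d)
    (hdec : eigendecomposition A lambda a) :
  exists opt : R, is_max (spca_values k r A) opt /\
  forall c : relaxation,
  exists ub : R, is_max (CIP_values c N k r lambda a) ub /\
    opt <= ub /\
    ub <= rho c r ^+ 2 * opt
          + \sum_j (r%:R * theta k a j ^+ 2 * lambda j) / (4 * N%:R ^+ 2).
Proof.
have [AE _ _ lam0] := hdec; have kd : (0 < k <= d)%N by rewrite (leq_trans hr hrk).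
have trE (V : 'M[R]_(d, r)) : \tr (V^T *m A *m V) = spectral_form lambda a V V.
  by rewrite AE spectral_formE.
have [V0 FV0 V0max] := form_attained a hrk hkd lam0 (r := r).
pose opt := spectral_form lambda a V0 V0.
have opt0 : 0 <= opt := spectral_form_ge0 _ lam0 _.
have sparse_le (U : 'M[R]_(d, r)) (S : {set 'I_d}) c :
    (#|S| <= k)%N -> (forall i, i \notin S -> row i U = 0) -> 0 <= c ->
    (forall x, dotp (U *m x) (U *m x) <= c * dotp x x) ->
    spectral_form lambda a U U <= c * opt.
  move=> Sk US c0 Uc.
  have [|V [S' [VV S'k VS' UV]]] :=
    @sparse_form_le R d lambda a lam0 r k U S c _ Sk US c0 Uc; first by rewrite hrk.
  apply: le_trans UV _; rewrite ler_wpM2l // V0max //.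
  exact: feasible_sparse S'k VS'.
exists opt; split.
  split; first by exists V0.
  by move=> _ [V FV <-]; rewrite trE; apply: V0max.
move=> c.
have in_theta (V : 'M[R]_(d, r)) : feasible k V -> within_theta k a V.
  by move=> FV [i j]; apply: feasible_theta.
have [||V [cV tV] Vmax] := @CR_attained R d r c k (within_theta k a)
  (@cip_objective R d k r N lambda a) hr (closed_within_theta (a := a)).
- exact: continuous_cip_objective.
- by exists V0; split; [apply: feasible_CR|apply: in_theta].
exists (cip_objective k N lambda a V); split; last split.
- have CP v := @CIP_valuesP R d k r N lambda a hN c v.
  split; first by apply/CP; exists V.
  by move=> v /CP[W [W1 ->]]; apply: Vmax.
(* The sparse optimum is admissible for the integer program, and the interpolant overestimates the
   square. *)
- apply: le_trans (form_le_cip hN lam0 (in_theta _ FV0)) _.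
  by apply: Vmax; split; [apply: feasible_CR|apply: in_theta].
- apply: le_trans (cip_le_form hN lam0 tV) _; rewrite lerD2r.
  case: c cV {Vmax} => cV.
  + exact: CR1_form_le cV.
  + exact: CR1'_form_le cV.
  + exact: CR2_form_le cV.
Qed.
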